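(* Let $0<\delta<\beta\le n$ and $p\in[1,\infty)$. (i) If $p\in(1,\infty)$, then $$\mathcal A_{p,\delta}\subsetneqq\mathcal A_{\frac{p\delta+\beta-\delta}{\beta},\,\beta}\subsetneqq\mathcal A_{p,\beta}.$$ (ii) For $p=1$, $\mathcal A_{1,\delta}\subsetneqq\mathcal A_{1,\beta}$.
   Context: All weights are functions on $\mathbb R^n$. A cube $Q\subset\mathbb R^n$ is a left-open right-closed cube with sides parallel to the axes; $l(Q)$ is its edge length. For $\delta\in(0,n]$ and $E\subset\mathbb R^n$, the Hausdorff content is $\mathcal H^\delta_\infty(E):=\inf\{\sum_i l(Q_i)^\delta:\ E\subset\bigcup_i Q_i\}$, the infimum over all finite or countable coverings of $E$ by cubes. For $E\subset\mathbb R^n$ and a non-negative function $g$ (no measurability required) the Choquet integral is $\int_E g\,d\mathcal H^\delta_\infty:=\int_0^\infty \mathcal H^\delta_\infty(\{x\in E: g(x)>t\})\,dt$. ''Almost everywhere'' with respect to $\mathcal H^\delta_\infty$ means outside a set of zero $\mathcal H^\delta_\infty$-content. An $\mathcal H^\delta_\infty$-capacitary weight is a non-negative function $w$ with $\int_E w\,d\mathcal H^\delta_\infty<\infty$ for all compact $E$ and $w\in(0,\infty)$ $\mathcal H^\delta_\infty$-almost everywhere. For $p\in(1,\infty)$, $w\in\mathcal A_{p,\delta}$ means $w$ is an $\mathcal H^\delta_\infty$-capacitary weight with $[w]_{\mathcal A_{p,\delta}}:=\sup_Q\{\frac1{\mathcal H^\delta_\infty(Q)}\int_Qw\,d\mathcal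 H^\delta_\infty\}\{\frac1{\mathcal H^\delta_\infty(Q)}\int_Qw^{-\frac1{p-1}}d\mathcal H^\delta_\infty\}^{p-1}<\infty$ (supremum over all cubes). $w\in\mathcal A_{1,\delta}$ means $w$ is an $\mathcal H^\delta_\infty$-capacitary weight with $[w]_{\mathcal A_{1,\delta}}:=\inf\{K\in(0,\infty):\ \mathcal M_{\mathcal H^\delta_\infty}w\le Kw\ \ \mathcal H^\delta_\infty\text{-a.e.}\}<\infty$, where $\mathcal M_{\mathcal H^\delta_\infty}f(x):=\sup_{Q\ni x}\frac1{\mathcal H^\delta_\infty(Q)}\int_Q|f|\,d\mathcal H^\delta_\infty$, the supremum over all cubes containing $x$. *)

(* Defs.v *)
From HB Require Import structures.
From mathcomp Require Import all_boot all_order all_algebra.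
From mathcomp Require Import all_classical all_reals all_analysis.

Set Implicit Arguments.
Unset Strict Implicit.
Unset Printing Implicit Defensive.

Import Order.TTheory GRing.Theory Num.Theory.
Import numFieldNormedType.Exports.

Local Open Scope classical_set_scope.
Local Open Scope ring_scope.
Local Open Scope ereal_scope.

Section capacitary_weights.
Context {R : realType} {n : nat}.
Implicit Types (delta p a : R) (E Q N : set 'rV[R]_n) (f w : 'rV[R]_n -> \bar R).

Definition cube (c : 'rV[R]_n) (l : R) : set 'rV[R]_n :=
  [set x | forall i, (c ord0 i < x ord0 i <= c ord0 i + l)%R].

Definition cubes : set (set 'rV[R]_n) :=
  [set Q | exists c l, (0 < l)%R /\ Q = cube c l].

(* A finite or countable covering is a family indexed by an arbitrary set D of
   natural numbers. *)
Definition hausdorff_content delta E : \bar R :=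
  ereal_inf [set s | exists (D : set nat) (c : nat -> 'rV[R]_n) (l : nat -> R),
    [/\ forall i, D i -> (0 < l i)%R,
        E `<=` \bigcup_(i in D) cube (c i) (l i) &
        s = \esum_(i in D) (l i `^ delta)%:E]].

Definition choquet_integral delta E f : \bar R :=
  \int[lebesgue_measure]_(t in `]0%R, +oo[)
    hausdorff_content delta (E `&` [set x | t%:E < f x]).

Definition content_ae delta (P : 'rV[R]_n -> Prop) : Prop :=
  exists2 N, hausdorff_content delta N = 0 & forall x, ~ N x -> P x.

Definition content_average delta Q f : \bar R :=
  (hausdorff_content delta Q)^-1 * choquet_integral delta Q f.

(* Weights take values in [0, +oo], being finite and positive only almost
   everywhere. *)
Definition capacitary_weight delta w : Prop :=
  [/\ forall x, 0 <= w x,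
      forall E, compact E -> choquet_integral delta E w < +oo &
      content_ae delta (fun x => 0 < w x < +oo)].

(* w ^ (- a) for a > 0, with the conventions 0 ^ (- a) = +oo and
   (+oo) ^ (- a) = 0; the library's power does not follow them at negative
   exponents. *)
Definition neg_power w a : 'rV[R]_n -> \bar R := fun x => (w x `^ a)^-1.

Definition Ap_constant p delta w : \bar R :=
  ereal_sup [set content_average delta Q w *
                 content_average delta Q (neg_power w (p - 1)^-1%R) `^ (p - 1)
            | Q in cubes].

Definition content_maximal delta f : 'rV[R]_n -> \bar R := fun x =>
  ereal_sup [set content_average delta Q (fun y => `|f y|)
            | Q in [set Q | cubes Q /\ Q x]].

Definition A1_constant delta w : \bar R :=
  ereal_inf [set K%:E | K in [set K : R | (0 < K)%R /\
    content_ae delta (fun x => content_maximal delta w x <= K%:E * w x)]].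

(* Meaningful for 1 < p; the endpoint p = 1 is A1_class. *)
Definition Ap_class p delta : set ('rV[R]_n -> \bar R) :=
  [set w | capacitary_weight delta w /\ Ap_constant p delta w < +oo].

Definition A1_class delta : set ('rV[R]_n -> \bar R) :=
  [set w | capacitary_weight delta w /\ A1_constant delta w < +oo].

End capacitary_weights.

Arguments Ap_class {R} n p delta.
Arguments A1_class {R} n delta.

(* Main.v *)
Require Import Defs.
From HB Require Import structures.
From mathcomp Require Import all_boot all_order all_algebra.
From mathcomp Require Import all_classical all_reals all_analysis.
From mathcomp Require Import measurable_realfun.
From mathcomp Require Import ring lra.

Set Implicit Arguments.
Unset Strict Implicit.
Unset Printing Implicit Defensive.

Import Order.TTheory GRing.Theory Num.Theory.
Import numFieldNormedType.Exports.

Local Open Scope classical_set_scope.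
Local Open Scope ring_scope.

(** Write H^d for the content of dimension d, and let delta < beta.

    Inclusions.  Two comparisons of contents carry everything.  The first,
    H^beta(E) <= H^delta(E)^(beta/delta), holds for every set because an
    l^r sum with r >= 1 is at most the r-th power of the l^1 sum
    ([hausdorff_content_poweR_le]).  The second,
    H^beta(E) <= l^(beta - delta) H^delta(E), holds when E lies in a cube of
    edge l ([hausdorff_content_le_cube]).  Since a cube of edge l has content
    exactly l^d ([hausdorff_content_cube]), the second comparison says that
    averages over cubes decrease when the dimension grows; this is the
    inclusion for A_1, and it controls the average of w in the A_p product.
    The first comparison gives, through the layer-cake formula,
    avg_beta(f^(beta/delta)) <= C avg_delta(f)^(beta/delta)
    ([content_average_poweR_le]).  With q = (p delta + beta - delta)/beta one
    has 1/(q - 1) = (beta/delta)/(p - 1), so this inequality for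
    f = w^(-1/(p-1)) controls the other factor, and A_(p,delta) is contained in
    A_(q,beta).  Passing from q to a larger exponent is Jensen's inequality for
    Choquet averages ([content_average_jensen]).

    The layer-cake integrals contain powers of the level t, and the layer
    functions are merely monotone.  Changes of variables are avoided by sampling
    along a geometric progression: for a nonincreasing phi, the integral over
    the half-line is comparable with the sum of s a^k phi(s a^k), up to the part
    below s ([integral_geometric_le], [integral_geometric_ge]).  The map
    t |-> t^r sends geometric progressions to geometric progressions, and s is
    chosen freely in each application.

    Strictness.  If 0 < gamma < beta, then |x|^(-gamma) satisfies
    avg_beta(|x|^(-gamma)) <= C |y|^(-gamma) for every point y of the cube
    ([singular_weight_A1]), so it belongs to A_(1,beta) and to every A_(q,beta).
    For gamma = beta its H^beta-integral near the origin diverges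
    ([singular_weight_choquet]).  Hence |x|^(-delta) is not even a weight for
    H^delta, although it is in A_(1,beta) and A_(q,beta); and
    |x|^(beta (q - 1)) is in A_(p,beta) for p > q, but not in A_(q,beta),
    because its dual weight is |x|^(-beta). *)

(** * Integrals of monotone functions along geometric progressions *)

Section monotone_integral.
Context {R : realType}.
Local Open Scope ereal_scope.
Implicit Types (phi : R -> \bar R) (s a : R).
Local Notation mu := (@lebesgue_measure R).

Lemma nonincreasing_emeasurable (D : set R) phi : measurable D ->
  {homo phi : x y / (x <= y)%R >-> y <= x} -> measurable_fun D phi.
Proof.
move=> mD phi_ni _.
apply: (measurability _ (ErealGenCInfty.measurableE R)) => // _ [_ [r ->] <-].
apply: measurableI => //; apply: is_interval_measurable => u v/=.
rewrite !in_itv/= !andbT => _ rv w /andP[_ wv].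
by rewrite in_itv/= andbT (le_trans rv)// phi_ni.
Qed.

(** Bernoulli's inequality makes [a ^+ k] unbounded, and the least [k] with [t <
    s * a ^+ k] is positive because [s <= t]. *)
Lemma exists_geometric_cell s a (t : R) : (0 < s)%R -> (1 < a)%R ->
  (s <= t)%R -> exists k, (s * a ^+ k <= t < s * a ^+ k.+1)%R.
Proof.
move=> s0 a1 st.
have exk : exists k, (t < s * a ^+ k)%R.
  have : (t / s * (a - 1)^-1 < (Num.truncn (t / s * (a - 1)^-1)).+1%:R)%R.
    exact: truncnS_gt.
  set N := (_.+1) => tN; exists N.
  have bern : (1 + N%:R * (a - 1) <= a ^+ N)%R.
    elim: N {tN} => [|N IH]; first by rewrite mul0r addr0 expr0.
    rewrite exprS -natr1.
    have : (a * (1 + N%:R * (a - 1)) <= a * a ^+ N)%R.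
      by rewrite ler_pM2l// (lt_trans ltr01).
    have : (0 <= N%:R * (a - 1) ^+ 2)%R by rewrite mulr_ge0// sqr_ge0.
    nra.
  rewrite -ltr_pdivrMl// mulrC.
  apply: lt_le_trans bern.
  by move: tN; rewrite ltr_pdivrMr ?subr_gt0//; lra.
case: (ex_minnP exk) => -[|m] tm min_m.
  by move: tm; rewrite expr0 mulr1 ltNge st.
exists m; rewrite tm andbT leNgt; apply/negP => /min_m.
by rewrite ltnn.
Qed.

Lemma ge0_integral_geometric phi s a : (0 < s)%R -> (1 < a)%R ->
  (forall t, 0 <= phi t) -> {homo phi : x y / (x <= y)%R >-> y <= x} ->
  \int[mu]_(t in `[s, +oo[) phi t =
  \sum_(k <oo) \int[mu]_(t in `[(s * a ^+ k)%R, (s * a ^+ k.+1)%R[%classic) phi t.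
Proof.
move=> s0 a1 phi0 phi_ni.
have mon i j : (i <= j)%N -> (s * a ^+ i <= s * a ^+ j)%R.
  by move=> ij; rewrite ler_pM2l// ler_weXn2l// ltW.
rewrite (_ : [set` `[s, +oo[] = \bigcup_k `[(s * a ^+ k)%R, (s * a ^+ k.+1)%R[%classic); last first.
  apply/seteqP; split => [t/=|t [k _]/=]; rewrite !in_itv/= ?andbT.
    move=> /(exists_geometric_cell s0 a1)[k tk].
    by exists k => //=; rewrite in_itv.
  by move=> /andP[+ _]; apply: le_trans; have := mon 0%N k;
    rewrite expr0 mulr1; exact.
rewrite ge0_integral_bigcup//.
  apply: nonincreasing_emeasurable => //.
  by apply: bigcup_measurable => k _; exact: measurable_itv.
have key i j t : (s * a ^+ i <= t < s * a ^+ i.+1)%R ->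
    (s * a ^+ j <= t < s * a ^+ j.+1)%R -> (i <= j)%N.
  move=> /andP[it _] /andP[_ tj]; rewrite leqNgt; apply/negP => /mon ji.
  by move: (le_lt_trans (le_trans ji it) tj); rewrite ltxx.
apply/trivIsetP => i j _ _ ij; apply/seteqP; split => // t/= [].
rewrite !in_itv/= => ti tj; apply: (negP ij).
by rewrite eqn_leq (key _ _ _ ti tj) (key _ _ _ tj ti).
Qed.

Lemma integral_cst_itv (u v : R) (c : \bar R) : (u <= v)%R ->
  \int[mu]_(t in `[u, v[) c = c * (v - u)%:E.
Proof.
rewrite le_eqVlt => /predU1P[->|uv].
  by rewrite set_itvco0// integral_set0 subrr mule0.
by rewrite integral_cst//= lebesgue_measure_itv/= lte_fin uv EFinB.
Qed.

Lemma geometric_cell_bounds phi s a k : (0 < s)%R -> (1 < a)%R ->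
  (forall t, 0 <= phi t) -> {homo phi : x y / (x <= y)%R >-> y <= x} ->
  phi (s * a ^+ k.+1)%R * (s * a ^+ k * (a - 1))%:E
  <= \int[mu]_(t in `[(s * a ^+ k)%R, (s * a ^+ k.+1)%R[%classic) phi t
  <= phi (s * a ^+ k)%R * (s * a ^+ k * (a - 1))%:E.
Proof.
move=> s0 a1 phi0 phi_ni.
have le_k : (s * a ^+ k <= s * a ^+ k.+1)%R.
  by rewrite ler_pM2l// ler_weXn2l// ltW.
have -> : (s * a ^+ k * (a - 1) = s * a ^+ k.+1 - s * a ^+ k)%R.
  by rewrite exprS; ring.
have mphi : measurable_fun `[(s * a ^+ k)%R, (s * a ^+ k.+1)%R[%classic phi.
  exact: nonincreasing_emeasurable.
rewrite -!integral_cst_itv//; apply/andP; split;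
  apply: ge0_le_integral => //= t; rewrite in_itv/= => /andP[kt tk];
  by apply: phi_ni => //; exact: ltW.
Qed.

(** The cells [[s a^k, s a^(k+1)[] have length [(a - 1) s a^k], and on each of
    them [phi] is at most its value at the left end. Monotonicity gives
    nothing on []0, s[], hence the bound [B]. *)
Lemma integral_geometric_le phi s a (B : \bar R) : (0 < s)%R -> (1 < a)%R ->
  (forall t, 0 <= phi t) -> {homo phi : x y / (x <= y)%R >-> y <= x} ->
  (forall t, phi t <= B) ->
  \int[mu]_(t in `]0%R, +oo[) phi t <=
  s%:E * B + (a - 1)%:E * \sum_(k <oo) (s * a ^+ k)%:E * phi (s * a ^+ k)%R.
Proof.
move=> s0 a1 phi0 phi_ni phiB.
have a0 : (0 < a)%R by rewrite (lt_trans ltr01).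
have sa0 k : (0 <= s * a ^+ k)%R by rewrite mulr_ge0// ?exprn_ge0// ltW.
have <- : `]0%R, s[%classic `|` `[s, +oo[%classic = [set` `]0%R, +oo[].
  apply/seteqP; split => t/=; rewrite !in_itv/= !andbT.
    by move=> [/andP[]//|]; exact: lt_le_trans.
  by move=> t0; rewrite t0/=; case: (ltP t s) => st; [left|right].
rewrite ge0_integral_setU//; last 2 first.
- by apply: nonincreasing_emeasurable => //; exact: measurableU.
- rewrite disj_set2E; apply/eqP; apply/seteqP; split => // t [/=];
    rewrite !in_itv/= andbT.
  by move=> /andP[_ ts]; rewrite leNgt ts.
apply: leeD.
  have -> : s%:E * B = \int[mu]_(t in `]0%R, s[) B.
    by rewrite integral_cst//= lebesgue_measure_itv/= lte_fin s0 sube0 muleC.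
  apply: ge0_le_integral => //=.
  exact: nonincreasing_emeasurable.
rewrite (ge0_integral_geometric s0 a1)// -nneseriesZl; last first.
  by move=> k _; rewrite mule_ge0 ?lee_fin.
apply: lee_nneseries => k _.
  by move=> _; apply: integral_ge0 => t _.
have /andP[_] := geometric_cell_bounds k s0 a1 phi0 phi_ni.
by move/le_trans; apply; rewrite muleA -EFinM muleC (mulrC (a - 1)%R).
Qed.

(** Here [phi] is bounded below on each cell by its value at the right end, so
    the progression is started one step earlier, at [s / a]. *)
Lemma integral_geometric_ge phi s a : (0 < s)%R -> (1 < a)%R ->
  (forall t, 0 <= phi t) -> {homo phi : x y / (x <= y)%R >-> y <= x} ->
  (1 - a^-1)%:E * (\sum_(k <oo) (s * a ^+ k)%:E * phi (s * a ^+ k)%R) <=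
  \int[mu]_(t in `]0%R, +oo[) phi t.
Proof.
move=> s0 a1 phi0 phi_ni.
have a0 : (0 < a)%R by rewrite (lt_trans ltr01).
have sa0 k : (0 <= s * a ^+ k)%R by rewrite mulr_ge0// ?exprn_ge0// ltW.
have sV0 : (0 < s / a)%R by rewrite divr_gt0.
apply: (@le_trans _ _ (\int[mu]_(t in `[(s / a)%R, +oo[%classic) phi t));
  last first.
  apply: ge0_subset_integral => //; first exact: nonincreasing_emeasurable.
  by move=> t/=; rewrite !in_itv/= !andbT; exact: lt_le_trans.
rewrite (ge0_integral_geometric sV0 a1)// -nneseriesZl; last first.
  by move=> k _; rewrite mule_ge0 ?lee_fin.
apply: lee_nneseries => k _.
  move=> _; rewrite mule_ge0 ?mule_ge0 ?lee_fin//.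
  by rewrite subr_ge0 invf_le1// ltW.
have /andP[+ _] := geometric_cell_bounds k sV0 a1 phi0 phi_ni.
apply: le_trans.
have -> : (s / a * a ^+ k.+1 = s * a ^+ k)%R by rewrite exprS; field;
  rewrite gt_eqF.
rewrite muleA -EFinM muleC lee_wpmul2l// lee_fin.
by rewrite le_eqVlt; apply/orP; left; apply/eqP; field; rewrite gt_eqF.
Qed.

End monotone_integral.

(** * Powers and series *)

Section power_sums.
Context {R : realType}.
Local Open Scope ereal_scope.
Implicit Types (x y : \bar R) (r : R).

Lemma ge0_le_poweR r x y : (0 <= r)%R -> 0 <= x -> x <= y -> x `^ r <= y `^ r.
Proof.
move=> r0 x0 xy.
by apply: gt0_ler_poweR => //; rewrite in_itv/= leey andbT// (le_trans x0).
Qed.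

(** Each term is at most the sum [X], so its [r]-th power is at most [X^(r-1)]
    times the term. *)
Lemma nneseries_poweR_le r (P : pred nat) (u : nat -> \bar R) : (1 <= r)%R ->
  (forall i, P i -> 0 <= u i) ->
  \sum_(i <oo | P i) u i `^ r <= (\sum_(i <oo | P i) u i) `^ r.
Proof.
move=> r1 u0.
have r0 : (0 < r)%R by rewrite (lt_le_trans ltr01).
set X := \sum_(i <oo | P i) u i.
have X0 : 0 <= X by apply: nneseries_ge0 => i _; exact: u0.
have [->|Xoo] := eqVneq X +oo; first by rewrite poweRyr ?leey// gt_eqF.
have uX i : P i -> u i <= X.
  move=> Pi; apply: le_trans (nneseries_lim_ge i.+1 _); last by move=> k _;
    exact: u0.
  rewrite big_mkcond big_nat_recr//= Pi leeDr//.
  by apply: sume_ge0 => j _; case: ifPn => // /u0.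
have powE x : 0 <= x -> x `^ r = x `^ (r - 1) * x.
  move=> x0; have /poweRD : poweRD_def x (r - 1)%R 1%R.
    by apply: add_neq0_poweRD_def; rewrite subrK gt_eqF.
  by rewrite subrK poweRe1.
have Xr : X `^ (r - 1) \is a fin_num.
  by rewrite fin_num_poweR// ge0_fin_numE// ltey.
rewrite (powE _ X0) -(fineK Xr) -nneseriesZl//.
apply: lee_nneseries => [i _ _|i Pi]; first exact: poweR_ge0.
rewrite fineK// powE ?u0// lee_wpmul2r ?u0// ge0_le_poweR ?u0 ?uX//.
by rewrite subr_ge0.
Qed.

Lemma esum_nneseries (D : set nat) (a : nat -> \bar R) :
  (forall i, D i -> 0 <= a i) ->
  \esum_(i in D) a i = \sum_(i <oo | i \in D) a i.
Proof.
by move=> a0; rewrite nneseries_esum ?set_mem_set// => i; rewrite inE; exact: a0.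
Qed.

End power_sums.

(** * Volumes of boxes *)

Section boxes.
Context {R : realType}.
Local Open Scope ereal_scope.
Local Notation mu := (@lebesgue_measure R).

(** Countable subadditivity of the volume, by Tonelli: slicing at a value of the
    last coordinate reduces the dimension, and integrating over that
    coordinate recovers the volumes. The weights [w] make the induction
    close, since they absorb the indicator of the boxes that meet the slice;
    for the same reason the covering hypothesis is that a weighted sum of
    indicators is at least 1. *)
Lemma box_volume_le m (w : nat -> R) (a b : nat -> R) (A B : nat -> nat -> R) :
  (forall i, 0 <= w i)%R -> (forall j, a j <= b j)%R ->
  (forall i j, A i j <= B i j)%R ->
  (forall x : nat -> R, (forall j, (j < m)%N -> a j < x j <= b j)%R ->
     1 <= \sum_(i <oo) (w i * \prod_(j < m) \1_(`]A i j, B i j]) (x j))%:E) ->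
  (\prod_(j < m) (b j - a j))%:E <=
  \sum_(i <oo) (w i * \prod_(j < m) (B i j - A i j))%:E.
Proof.
elim: m w => [|m IH] w w0 ab AB cov.
  rewrite big_ord0; have := cov (fun=> 0%R) _.
  under eq_eseriesr do rewrite big_ord0.
  under [X in _ -> _ <= X]eq_eseriesr do rewrite big_ord0.
  exact.
pose V := (\prod_(j < m) (b j - a j))%R.
pose v i := (\prod_(j < m) (B i j - A i j))%R.
have v0 i : (0 <= v i)%R by rewrite prodr_ge0// => j _; rewrite subr_ge0.
pose I i := `](A i m), (B i m)]%classic.
have slice t : (a m < t <= b m)%R ->
    V%:E <= \sum_(i <oo) (w i * v i * \1_(I i) t)%:E.
  move=> tab.
  have -> : \sum_(i <oo) (w i * v i * \1_(I i) t)%:E =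
            \sum_(i <oo) (w i * \1_(I i) t * v i)%:E.
    by apply: eq_eseriesr => i _; rewrite mulrAC.
  apply: IH => //; first by move=> i; rewrite mulr_ge0.
  move=> x xab; pose y j := if j == m then t else x j.
  apply: le_trans (cov y _) _.
    move=> j; rewrite ltnS leq_eqVlt /y; case: eqVneq => [->//|_] /=.
    exact: xab.
  apply: lee_nneseries => [i _ _|i _].
    by rewrite lee_fin mulr_ge0// prodr_ge0.
  rewrite lee_fin big_ord_recr/= /y eqxx -mulrA (mulrC (\1__ t)).
  rewrite le_eqVlt; apply/orP; left; apply/eqP; congr (_ * (_ * _))%R.
  by apply: eq_bigr => j _; rewrite (ltn_eqF (ltn_ord j)).
rewrite big_ord_recr/= EFinM.
have -> : V%:E * (b m - a m)%:E = \int[mu]_(t in `](a m), (b m)]) V%:E.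
  rewrite integral_cst//= lebesgue_measure_itv/= lte_fin; case: ltP => //.
  by move=> ba; have /eqP -> : b m == a m; rewrite ?eq_le ?ba ?ab// subrr mule0.
have mI i : measurable_fun `](a m), (b m)] (fun t => (w i * v i * \1_(I i) t)%:E).
  apply/measurable_EFinP; apply: measurable_funM => //.
  by apply: measurable_indic; exact: measurable_itv.
apply: (@le_trans _ _ (\int[mu]_(t in `](a m), (b m)])
    (\sum_(i <oo) (w i * v i * \1_(I i) t)%:E))).
  apply: ge0_le_integral => //.
  - by move=> t _; rewrite lee_fin prodr_ge0// => j _; rewrite subr_ge0.
  - apply: ge0_emeasurable_sum => [i t _ _|i _]; last exact: mI.
    by rewrite lee_fin !mulr_ge0.
rewrite integral_nneseries//; last first.
  by move=> i t _; rewrite lee_fin !mulr_ge0.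
apply: lee_nneseries => [i _ _|i _].
  by apply: integral_ge0 => t _; rewrite lee_fin !mulr_ge0.
under eq_integral do rewrite EFinM.
rewrite ge0_integralZl//; last 2 first.
- by apply/measurable_EFinP/measurable_indic; exact: measurable_itv.
- by rewrite lee_fin mulr_ge0.
rewrite integral_indic//; last exact: measurable_itv.
rewrite big_ord_recr/= mulrA [leRHS]EFinM lee_wpmul2l ?lee_fin ?mulr_ge0//.
apply: (@le_trans _ _ (mu (I i))).
  apply: le_measure; rewrite ?inE//; last exact: measurable_itv.
  by apply: measurableI => //; exact: measurable_itv.
rewrite lebesgue_measure_itv/= lte_fin; case: ltP => _.
  by rewrite -EFinB.
by rewrite lee_fin subr_ge0.
Qed.

End boxes.

(** * Hausdorff contents of different dimensions *)

Section content.
Context {R : realType} {n : nat}.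
Local Open Scope ereal_scope.
Implicit Types (E F : set 'rV[R]_n) (delta beta : R).
Local Notation H := hausdorff_content.

Lemma hausdorff_content_ge0 delta E : 0 <= H delta E.
Proof.
apply: le_ereal_inf_tmp => _ [D [c [l [l0 _ ->]]]].
by apply: esum_ge0 => i _; rewrite lee_fin powR_ge0.
Qed.

Lemma le_hausdorff_content delta E F : E `<=` F -> H delta E <= H delta F.
Proof.
move=> EF; apply: ereal_inf_le_tmp => s [D [c [l [l0 FD ->]]]].
by exists D, c, l; split => //; exact: subset_trans FD.
Qed.

Lemma hausdorff_content0 delta : H delta (@set0 'rV[R]_n) = 0.
Proof.
apply/eqP; rewrite eq_le hausdorff_content_ge0 andbT; apply: ereal_inf_lbound.
exists set0, (fun=> 0%R), (fun=> 0%R); split => //.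
by rewrite esum_set0.
Qed.

Lemma hausdorff_content_cube_le delta (c : 'rV[R]_n) (l : R) : (0 < l)%R ->
  H delta (cube c l) <= (l `^ delta)%:E.
Proof.
move=> l0; apply: ereal_inf_lbound; exists [set 0%N], (fun=> c), (fun=> l).
split => //; first by rewrite bigcup_set1.
by rewrite esum_set1// lee_fin powR_ge0.
Qed.

(** The case [delta = n] of the lower bound for the content of a cube. *)
Lemma volume_cover_ge (c : 'rV[R]_n) (l : R) (D : set nat)
    (C : nat -> 'rV[R]_n) (L : nat -> R) : (0 <= l)%R ->
  (forall i, D i -> 0 <= L i)%R ->
  cube c l `<=` \bigcup_(i in D) cube (C i) (L i) ->
  (l ^+ n)%:E <= \sum_(i <oo | i \in D) (L i ^+ n)%:E.
Proof.
move=> l0 L0 cov.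
(* coordinates indexed by all natural numbers, 0 beyond the dimension *)
pose coord (x : 'rV[R]_n) (j : nat) := oapp (x ord0) 0%R (insub j : option 'I_n).
have coordE x (j : 'I_n) : coord x j = x ord0 j by rewrite /coord valK.
have := @box_volume_le R n (fun i => (i \in D)%:R) (coord c)
  (fun j => coord c j + l)%R (fun i => coord (C i)) (fun i j => coord (C i) j + `|L i|)%R.
under eq_bigr do rewrite addrAC subrr add0r.
rewrite prodr_const card_ord.
under [X in (_ -> _ -> _ -> _ -> _ <= X) -> _]eq_eseriesr => i _.
  under eq_bigr do rewrite addrAC subrr add0r.
  rewrite prodr_const card_ord.
  over.
have -> : \sum_(i <oo | i \in D) (L i ^+ n)%:E =
    \sum_(i <oo) ((i \in D)%:R * `|L i| ^+ n)%:E.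
  rewrite eseries_mkcond; apply: eq_eseriesr => i _.
  by case: ifPn => [/set_mem/L0 Li|_]; rewrite ?mul1r ?mul0r// ger0_norm.
apply => [i|j|i j|x xc].
- by rewrite ler0n.
- by rewrite lerDl.
- by rewrite lerDl.
have [|i Di xi] := cov (\row_j x j).
  by move=> j; rewrite mxE -coordE xc.
apply: le_trans (nneseries_lim_ge i.+1 _); last first.
  by move=> k _ _; rewrite lee_fin mulr_ge0// prodr_ge0.
rewrite big_nat_recr//=; apply: le_trans (leeDr _ _); last first.
  by apply: sume_ge0 => k _; rewrite lee_fin mulr_ge0// prodr_ge0.
rewrite lee_fin mem_set// mul1r big1// => j _.
rewrite indicE mem_set//= in_itv/= coordE ger0_norm ?L0//.
by have := xi j; rewrite mxE.
Qed.

(** If one cube of the covering has edge at least [l], it suffices alone.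
    Otherwise [(L i / l)^delta >= (L i / l)^n] for all [i], and the volume
    inequality applies. *)
Lemma hausdorff_content_cube delta (c : 'rV[R]_n) (l : R) :
  (0 < delta)%R -> (delta <= n%:R)%R -> (0 < l)%R ->
  H delta (cube c l) = (l `^ delta)%:E.
Proof.
move=> d0 dn l0; apply/eqP; rewrite eq_le hausdorff_content_cube_le//=.
apply: le_ereal_inf_tmp => _ [D [C [L [L0 cov ->]]]].
rewrite esum_nneseries; last by move=> i _; rewrite lee_fin powR_ge0.
have [[i [Di lL]]|small] := pselect (exists i, D i /\ l <= L i)%R.
  apply: le_trans (nneseries_lim_ge i.+1 _); last first.
    by move=> k _ _; rewrite lee_fin powR_ge0.
  rewrite big_mkcond big_nat_recr//= mem_set//.
  apply: le_trans (leeDr _ _); last first.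
    by apply: sume_ge0 => k _; case: ifP; rewrite ?lee_fin ?powR_ge0.
  by rewrite lee_fin ge0_ler_powR ?nnegrE// ltW// (lt_le_trans l0).
have vol := volume_cover_ge (ltW l0) (fun i Di => ltW (L0 i Di)) cov.
have -> : (l `^ delta)%:E = (l `^ (delta - n%:R))%:E * (l ^+ n)%:E.
  by rewrite -EFinM -powR_mulrn ?ltW// -powRD ?subrK// (gt_eqF l0) implybT.
apply: (@le_trans _ _ ((l `^ (delta - n%:R))%:E *
    \sum_(i <oo | i \in D) (L i ^+ n)%:E)).
  by rewrite lee_wpmul2l// lee_fin powR_ge0.
rewrite -nneseriesZl; last first.
  by move=> i /set_mem/L0/ltW ?; rewrite lee_fin exprn_ge0.
apply: lee_nneseries => [i _ /set_mem/L0/ltW ?|i /set_mem Di].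
  by rewrite lee_fin mulr_ge0 ?powR_ge0 ?exprn_ge0.
have Li0 := L0 _ Di.
have Ll : (L i <= l)%R by rewrite leNgt; apply/negP => /ltW ?; apply: small;
  exists i.
rewrite -EFinM lee_fin -opprB powRN ler_pdivrMl ?powR_gt0//.
have -> : (L i ^+ n = L i `^ (n%:R - delta) * L i `^ delta)%R.
  by rewrite -powRD ?subrK ?powR_mulrn// ?ltW// (gt_eqF Li0) implybT.
by rewrite ler_wpM2r ?powR_ge0// ge0_ler_powR ?nnegrE ?subr_ge0// ltW.
Qed.

(** Apply [nneseries_poweR_le] to the edges [L i ^ delta] of a covering; the
    infimum over coverings is taken after moving the exponent to the
    left-hand side. *)
Lemma hausdorff_content_poweR_le delta beta E : (0 < delta <= beta)%R ->
  H beta E <= H delta E `^ (beta / delta).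
Proof.
move=> /andP[d0 db]; have b0 := lt_le_trans d0 db.
have r1 : (1 <= beta / delta)%R by rewrite ler_pdivlMr// mul1r.
have r0 : (0 < beta / delta)%R by rewrite divr_gt0.
suff : H beta E `^ (delta / beta) <= H delta E.
  move=> /(ge0_le_poweR (ltW r0) (poweR_ge0 _ _)).
  rewrite -poweRrM (_ : delta / beta * (beta / delta) = 1)%R.
    by rewrite poweRe1// hausdorff_content_ge0.
  by field; rewrite !gt_eqF.
apply: le_ereal_inf_tmp => _ [D [C [L [L0 cov ->]]]].
rewrite esum_nneseries; last by move=> i _; rewrite lee_fin powR_ge0.
set S := (X in _ <= X).
have S0 : 0 <= S by apply: nneseries_ge0 => i _ _; rewrite lee_fin powR_ge0.
have le_S : H beta E <= S `^ (beta / delta).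
  apply: le_trans (nneseries_poweR_le r1 _); last first.
    by move=> i _; rewrite lee_fin powR_ge0.
  apply: ereal_inf_lbound; exists D, C, L; split => //.
  rewrite esum_nneseries; last by move=> i _; rewrite lee_fin powR_ge0.
  apply: eq_eseriesr => i _; rewrite poweR_EFin -powRrM; congr (_ `^ _)%:E.
  by field; rewrite gt_eqF.
have := ge0_le_poweR (ltW (divr_gt0 d0 b0)) (hausdorff_content_ge0 beta E) le_S.
move=> /le_trans; apply; rewrite -poweRrM (_ : beta / delta * (delta / beta) = 1)%R.
  by rewrite poweRe1.
by field; rewrite !gt_eqF.
Qed.

Lemma hausdorff_content_eq0 delta beta E : (0 < delta <= beta)%R ->
  H delta E = 0 -> H beta E = 0.
Proof.
move=> db E0; have /andP[d0 b0] := db; have := hausdorff_content_poweR_le E db.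
rewrite E0 poweR0r ?gt_eqF ?divr_gt0 ?(lt_le_trans d0)// => Hb.
by apply/eqP; rewrite eq_le Hb hausdorff_content_ge0.
Qed.

(** A covering by cubes of edge at most [l] satisfies [L i ^ beta <= l ^ (beta -
    delta) * L i ^ delta] term by term; a covering with a larger cube is no
    better than [cube c l] itself. *)
Lemma hausdorff_content_le_cube delta beta (c : 'rV[R]_n) (l : R) E :
  (0 < delta <= beta)%R -> (0 < l)%R -> E `<=` cube c l ->
  H beta E <= (l `^ (beta - delta))%:E * H delta E.
Proof.
move=> /andP[d0 db] l0 Ecl; have b0 := lt_le_trans d0 db.
have p0 : (0 < l `^ (beta - delta))%R by rewrite powR_gt0.
have powB x : (0 < x)%R -> (x `^ beta = x `^ (beta - delta) * x `^ delta)%R.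
  by move=> x0; rewrite -powRD ?subrK// (gt_eqF x0) implybT.
rewrite -lee_pdivrMl//; apply: le_ereal_inf_tmp => _ [D [C [L [L0 cov ->]]]].
rewrite lee_pdivrMl// esum_nneseries; last by move=> i _; rewrite lee_fin powR_ge0.
have [[i [Di lL]]|small] := pselect (exists i, D i /\ l <= L i)%R.
  apply: le_trans (le_hausdorff_content _ Ecl) _.
  apply: le_trans (hausdorff_content_cube_le _ _ l0) _.
  rewrite powB// EFinM lee_wpmul2l ?lee_fin ?powR_ge0//.
  apply: le_trans (nneseries_lim_ge i.+1 _); last first.
    by move=> k _ _; rewrite lee_fin powR_ge0.
  rewrite big_mkcond big_nat_recr//= mem_set//.
  apply: le_trans (leeDr _ _); last first.
    by apply: sume_ge0 => k _; case: ifP; rewrite ?lee_fin ?powR_ge0.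
  by rewrite lee_fin ge0_ler_powR ?nnegrE// ltW// (lt_le_trans l0).
apply: (@le_trans _ _ (\sum_(i <oo | i \in D) (L i `^ beta)%:E)).
  apply: ereal_inf_lbound; exists D, C, L; split => //.
  by rewrite esum_nneseries// => i _; rewrite lee_fin powR_ge0.
rewrite -nneseriesZl; last by move=> i _; rewrite lee_fin powR_ge0.
apply: lee_nneseries => [i _ _|i /set_mem Di]; first by rewrite lee_fin powR_ge0.
have Li0 := L0 _ Di.
have Ll : (L i <= l)%R by rewrite leNgt; apply/negP => /ltW ?; apply: small;
  exists i.
rewrite -EFinM lee_fin powB// ler_wpM2r ?powR_ge0//.
by rewrite ge0_ler_powR ?nnegrE ?subr_ge0// ltW.
Qed.

End content.

(** * Choquet integrals *)

Section choquet.
Context {R : realType} {n : nat}.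
Local Open Scope ereal_scope.
Implicit Types (E F : set 'rV[R]_n) (f g u : 'rV[R]_n -> \bar R).
Implicit Types (delta beta r s a : R).
Local Notation H := hausdorff_content.
Local Notation I := choquet_integral.
Local Notation mu := (@lebesgue_measure R).

Let lt12 : (1 < 2 :> R)%R. Proof. by rewrite ltr1n. Qed.

Definition level_content delta E f (t : R) : \bar R :=
  H delta (E `&` [set x | t%:E < f x]).

Lemma level_content_ge0 delta E f t : 0 <= level_content delta E f t.
Proof. exact: hausdorff_content_ge0. Qed.

Lemma level_content_ni delta E f :
  {homo level_content delta E f : x y / (x <= y)%R >-> y <= x}.
Proof.
move=> t t' tt'; apply: le_hausdorff_content => x [Ex /= ft]; split => //=.
by apply: le_lt_trans ft; rewrite lee_fin.
Qed.

Lemma level_content_le delta E f t : level_content delta E f t <= H delta E.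
Proof. by apply: le_hausdorff_content => x []. Qed.

Lemma choquet_integral_ge0 delta E f : 0 <= I delta E f.
Proof. by apply: integral_ge0 => t _; exact: level_content_ge0. Qed.

(** Comparing Choquet integrals of different dimensions, domains and integrands
    only requires comparing the contents of the level sets. *)
Lemma choquet_integralZ_le (C : R) delta beta E F f g : (0 <= C)%R ->
  (forall t, (0 < t)%R ->
    level_content beta E f t <= C%:E * level_content delta F g t) ->
  I beta E f <= C%:E * I delta F g.
Proof.
move=> C0 le_fg.
have m_level (D : set R) d' E' f' :
    measurable D -> measurable_fun D (level_content d' E' f').
  by move=> mD; apply: nonincreasing_emeasurable => //; exact: level_content_ni.
rewrite -ge0_integralZl//; last 2 first.
- exact: m_level.
- by move=> t _; exact: level_content_ge0.
apply: ge0_le_integral => //.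
- by move=> t _; exact: level_content_ge0.
- exact: m_level.
- by apply: measurable_funeM; exact: m_level.
- by move=> t; rewrite /= in_itv/= andbT => t0; exact: le_fg.
Qed.

Lemma le_choquet_integral delta E F f g : E `<=` F ->
  (forall x, E x -> f x <= g x) -> I delta E f <= I delta F g.
Proof.
move=> EF fg; rewrite -[leRHS]mul1e; apply: choquet_integralZ_le => // t t0.
rewrite mul1e; apply: le_hausdorff_content => x [Ex /= ft].
by split; [exact: EF|exact: lt_le_trans (fg _ Ex)].
Qed.

Lemma choquet_geometric_le delta E f s a : (0 < s)%R -> (1 < a)%R ->
  I delta E f <= s%:E * H delta E +
    (a - 1)%:E * \sum_(k <oo) (s * a ^+ k)%:E * level_content delta E f (s * a ^+ k).
Proof.
move=> s0 a1; apply: (integral_geometric_le (phi := level_content delta E f)) => //.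
- exact: level_content_ge0.
- exact: level_content_ni.
- exact: level_content_le.
Qed.

Lemma choquet_geometric_ge delta E f s a : (0 < s)%R -> (1 < a)%R ->
  \sum_(k <oo) (s * a ^+ k)%:E * level_content delta E f (s * a ^+ k) <=
  ((1 - a^-1)^-1)%:E * I delta E f.
Proof.
move=> s0 a1; rewrite lee_pdivlMl.
  apply: (integral_geometric_ge (phi := level_content delta E f)) => //.
    exact: level_content_ge0.
  exact: level_content_ni.
by rewrite subr_gt0 invf_lt1// (lt_trans ltr01).
Qed.

Lemma choquet_integral_bounded delta E f (M : R) : (0 < M)%R ->
  (forall x, E x -> f x <= M%:E) -> I delta E f <= M%:E * H delta E.
Proof.
move=> M0 fM; apply: le_trans (choquet_geometric_le _ _ _ M0 lt12) _.
rewrite eseries0 ?mule0 ?adde0// => k _ _.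
rewrite /level_content (_ : _ `&` _ = set0) ?hausdorff_content0 ?mule0//.
apply/seteqP; split => // x [Ex /= Mf]; move: (lt_le_trans Mf (fM _ Ex)).
by rewrite lte_fin ltNge ler_peMr ?exprn_ege1 ?ler1n// ltW.
Qed.

Lemma choquet_integral_ge_level delta E f t : (0 < t)%R ->
  t%:E * level_content delta E f t <= 2%:E * I delta E f.
Proof.
move=> t0; have := choquet_geometric_ge delta E f t0 lt12.
rewrite (_ : (1 - 2^-1)^-1 = 2 :> R)%R; last by field.
apply: le_trans; apply: le_trans (nneseries_lim_ge 1 _).
  by rewrite big_nat1 expr0 mulr1.
move=> k _ _; rewrite mule_ge0 ?level_content_ge0// lee_fin.
by rewrite mulr_ge0 ?exprn_ge0// ltW.
Qed.

Lemma powR_gt1 a r : (1 < a)%R -> (0 < r)%R -> (1 < a `^ r)%R.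
Proof.
move=> a1 r0; have := gt0_ltr_powR r0 _ _ a1; rewrite powR1; apply.
  by rewrite nnegrE.
by rewrite nnegrE ltW// (lt_trans ltr01).
Qed.

Lemma lt_poweR r (x y : \bar R) : (0 < r)%R -> 0 <= x -> 0 <= y ->
  (x `^ r < y `^ r) = (x < y).
Proof.
move=> r0 x0 y0; apply/idP/idP; rewrite !ltNge; apply: contra.
  by apply: ge0_le_poweR => //; exact: ltW.
move=> /(ge0_le_poweR (ltW (_ : 0 < r^-1)%R) (poweR_ge0 _ _)).
by rewrite invr_gt0 -!poweRrM mulfV ?gt_eqF// !poweRe1//; exact.
Qed.

(** The reparametrization of level sets that replaces the change of variables [t
    |-> t ^ r]. *)
Lemma level_content_poweR delta E f r t : (0 < r)%R -> (0 <= t)%R ->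
  (forall x, 0 <= f x) ->
  level_content delta E (fun x => f x `^ r) (t `^ r) = level_content delta E f t.
Proof.
move=> r0 t0 f0; congr (H delta (_ `&` _)); apply/funext => x /=.
by rewrite -poweR_EFin lt_poweR.
Qed.

Lemma powR_geometric s a r k : (0 <= s)%R -> (0 <= a)%R ->
  ((s * a ^+ k) `^ r = s `^ r * (a `^ r) ^+ k)%R.
Proof.
move=> s0 a0; rewrite powRM ?exprn_ge0//; congr (_ * _)%R.
by rewrite -(powR_mulrn k a0) -(powR_mulrn k (powR_ge0 a r)) -!powRrM mulrC.
Qed.

(** Along the progression [s 2^k], the terms for [f ^ r] and [H^beta] are at
    most the [r]-th powers of the terms for [f] and [H^delta] along [s^(1/r)
    2^(k/r)], and [nneseries_poweR_le] applies. The part below [s]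
    contributes at most [s H^beta(E)], which tends to 0 with [s]. *)
Lemma choquet_integral_poweR_le delta beta E f :
  (0 < delta <= beta)%R -> H beta E < +oo -> (forall x, 0 <= f x) ->
  I beta E (fun x => f x `^ (beta / delta)) <=
  (((1 - (2 `^ (delta / beta))^-1)^-1) `^ (beta / delta))%:E *
    I delta E f `^ (beta / delta).
Proof.
move=> db HE f0; have /andP[d0 le_db] := db; have b0 := lt_le_trans d0 le_db.
set r := (beta / delta)%R; set K := (_^-1)%R.
have r0 : (0 < r)%R by rewrite divr_gt0.
have r1 : (1 <= r)%R by rewrite ler_pdivlMr// mul1r.
have rV : (delta / beta = r^-1)%R by rewrite /r invf_div.
have a1 : (1 < 2 `^ r^-1 :> R)%R by rewrite powR_gt1 ?invr_gt0.
rewrite -poweR_EFin -poweRM ?choquet_integral_ge0//; last first.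
  by rewrite lee_fin invr_ge0 subr_ge0 invf_le1 ?powR_gt0// rV ltW.
apply/lee_addgt0Pr => e e0.
have [m m0 Hm] : exists2 m : R, (0 < m)%R & H beta E <= m%:E.
  have HE0 := hausdorff_content_ge0 beta E.
  exists (fine (H beta E) + 1)%R; first by rewrite ltr_wpDl ?fine_ge0.
  by rewrite -[leLHS]fineK ?ge0_fin_numE// lee_fin lerDl.
(* starting level: the part below it contributes at most [e] *)
have s0 : (0 < e / m)%R by rewrite divr_gt0.
apply: le_trans (choquet_geometric_le _ _ _ s0 lt12) _.
rewrite addeC (_ : 2 - 1 = 1)%R ?mul1e; last by lra.
apply: leeD; last first.
  apply: (@le_trans _ _ ((e / m)%:E * m%:E)).
    by rewrite lee_wpmul2l// lee_fin ltW.
  by rewrite -EFinM divfK// gt_eqF.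
set s := (e / m)%R.
have sr0 : (0 < s `^ r^-1)%R by rewrite powR_gt0.
have term k : (s * 2 ^+ k)%:E *
    level_content beta E (fun x => f x `^ r) (s * 2 ^+ k) <=
    ((s `^ r^-1 * (2 `^ r^-1) ^+ k)%:E *
      level_content delta E f (s `^ r^-1 * (2 `^ r^-1) ^+ k)) `^ r.
  have sk0 : (0 <= s * 2 ^+ k)%R by rewrite mulr_ge0 ?exprn_ge0// ltW.
  rewrite -powR_geometric ?(ltW s0)//; set t := ((s * 2 ^+ k) `^ r^-1)%R.
  have -> : (s * 2 ^+ k = t `^ r)%R by rewrite /t -powRrM mulVf ?powRr1// gt_eqF.
  have t0 : (0 <= t)%R by rewrite powR_ge0.
  rewrite level_content_poweR// poweRM ?level_content_ge0// poweR_EFin.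
  rewrite lee_wpmul2l ?lee_fin ?powR_ge0//.
  exact: hausdorff_content_poweR_le.
apply: (@le_trans _ _ (\sum_(k <oo) ((s `^ r^-1 * (2 `^ r^-1) ^+ k)%:E *
      level_content delta E f (s `^ r^-1 * (2 `^ r^-1) ^+ k)) `^ r)).
  apply: lee_nneseries => [k _ _|k _]; last exact: term.
  by rewrite mule_ge0 ?level_content_ge0// lee_fin mulr_ge0 ?exprn_ge0// ltW.
have pos k : 0 <= (s `^ r^-1 * (2 `^ r^-1) ^+ k)%:E *
      level_content delta E f (s `^ r^-1 * (2 `^ r^-1) ^+ k).
  by rewrite mule_ge0 ?level_content_ge0// lee_fin mulr_ge0 ?exprn_ge0 ?powR_ge0.
apply: le_trans (nneseries_poweR_le r1 (fun k _ => pos k)) _.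
apply: ge0_le_poweR; first exact: ltW.
  by apply: nneseries_ge0 => k _ _; exact: pos.
by rewrite /K rV; exact: choquet_geometric_ge.
Qed.

(** Where [f] exceeds [lam] it is at most [lam^(1-r) f^r]; the levels below
    [lam] contribute at most [lam h]. The natural choice of [lam] is the
    [r]-th root of the average of [f ^ r], but this can vanish; any larger
    positive [lam] is admissible. *)
Lemma choquet_integral_jensen delta E f r (h lam : R) : (1 <= r)%R ->
  (0 < lam)%R -> (forall x, 0 <= f x) -> H delta E <= h%:E ->
  I delta E (fun x => f x `^ r) <= (lam `^ r * h)%:E ->
  I delta E f <= ((1 + (1 - (2 `^ r)^-1)^-1) * lam * h)%:E.
Proof.
move=> r1 lam0 f0 Hh Vh.
have r0 : (0 < r)%R by rewrite (lt_le_trans ltr01).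
have a1 : (1 < 2 `^ r :> R)%R by rewrite powR_gt1.
have K0 : (0 <= (1 - (2 `^ r)^-1)^-1 :> R)%R.
  by rewrite invr_ge0 subr_ge0 invf_le1 ?powR_gt0// ltW.
apply: le_trans (choquet_geometric_le _ _ _ lam0 lt12) _.
rewrite (_ : 2 - 1 = 1)%R ?mul1e; last by lra.
rewrite -mulrA mulrDl mul1r EFinD; apply: leeD.
  by rewrite EFinM lee_wpmul2l// lee_fin ltW.
have term k : (lam * 2 ^+ k)%:E * level_content delta E f (lam * 2 ^+ k) <=
    (lam `^ (1 - r))%:E * ((lam `^ r * (2 `^ r) ^+ k)%:E *
      level_content delta E (fun x => f x `^ r) (lam `^ r * (2 `^ r) ^+ k)).
  have lk0 : (0 <= lam * 2 ^+ k)%R by rewrite mulr_ge0 ?exprn_ge0// ltW.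
  rewrite -powR_geometric ?(ltW lam0)// level_content_poweR// muleA -EFinM.
  rewrite lee_wpmul2r ?level_content_ge0// lee_fin powR_geometric ?(ltW lam0)//.
  rewrite mulrA -powRD ?subrK ?powRr1 ?(ltW lam0) ?(gt_eqF lam0) ?implybT//
    ler_pM2l//.
  by rewrite lerXn2r ?nnegrE ?powR_ge0// le1r_powR// ler1n.
apply: (@le_trans _ _ ((lam `^ (1 - r))%:E * \sum_(k <oo)
    ((lam `^ r * (2 `^ r) ^+ k)%:E *
      level_content delta E (fun x => f x `^ r) (lam `^ r * (2 `^ r) ^+ k)))).
  rewrite -nneseriesZl; last first.
    move=> k _; rewrite mule_ge0 ?level_content_ge0// lee_fin.
    by rewrite mulr_ge0 ?exprn_ge0 ?powR_ge0.
  apply: lee_nneseries => [k _ _|k _]; last exact: term.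
  by rewrite mule_ge0 ?level_content_ge0// lee_fin mulr_ge0 ?exprn_ge0// ltW.
apply: (@le_trans _ _ ((lam `^ (1 - r))%:E *
    (((1 - (2 `^ r)^-1)^-1)%:E * (lam `^ r * h)%:E))).
  rewrite lee_wpmul2l ?lee_fin ?powR_ge0//.
  apply: le_trans (choquet_geometric_ge _ _ _ _ a1) _; first by rewrite powR_gt0.
  by rewrite lee_wpmul2l.
rewrite -!EFinM lee_fin mulrCA ler_wpM2l// mulrA -powRD.
  by rewrite subrK powRr1// ltW.
by rewrite (gt_eqF lam0) implybT.
Qed.

End choquet.

(** * Averages over cubes and the inclusions between weight classes *)

Section averages.
Context {R : realType} {n : nat}.
Local Open Scope ereal_scope.
Implicit Types (E F : set 'rV[R]_n) (f g u w : 'rV[R]_n -> \bar R).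
Implicit Types (delta beta r s a p q l : R) (c : 'rV[R]_n).
Local Notation H := hausdorff_content.
Local Notation I := choquet_integral.

Lemma content_averageE delta c l f : (0 < delta)%R -> (delta <= n%:R)%R ->
  (0 < l)%R ->
  content_average delta (cube c l) f = (l `^ (- delta))%:E * I delta (cube c l) f.
Proof.
move=> d0 dn l0; rewrite /content_average hausdorff_content_cube// inver.
by rewrite powR_eq0 gt_eqF//= powRN.
Qed.

Lemma content_average_ge0 delta E f : 0 <= content_average delta E f.
Proof.
by rewrite mule_ge0 ?inve_ge0 ?hausdorff_content_ge0 ?choquet_integral_ge0.
Qed.

Lemma choquet_integral_le_cube delta beta E c l f : (0 < delta <= beta)%R ->
  (0 < l)%R -> E `<=` cube c l ->
  I beta E f <= (l `^ (beta - delta))%:E * I delta E f.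
Proof.
move=> db l0 Ecl; apply: choquet_integralZ_le; first exact: powR_ge0.
by move=> t _; apply: hausdorff_content_le_cube => //;
  apply: subset_trans Ecl => x [].
Qed.

Lemma content_average_le delta beta c l f : (0 < delta <= beta)%R ->
  (beta <= n%:R)%R -> (0 < l)%R ->
  content_average beta (cube c l) f <= content_average delta (cube c l) f.
Proof.
move=> db bn l0; have /andP[d0 le_db] := db.
have b0 := lt_le_trans d0 le_db; have dn := le_trans le_db bn.
rewrite (content_averageE _ _ b0 bn l0) (content_averageE _ _ d0 dn l0).
apply: le_trans (lee_wpmul2l _ (choquet_integral_le_cube _ db l0 (@subset_refl _ _))) _.
  by rewrite lee_fin powR_ge0.
rewrite muleA -EFinM -powRD; last by rewrite (gt_eqF l0) implybT.
by rewrite addrA addNr add0r.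
Qed.

(** The factors [l^(-beta)] and [(l^(-delta))^(beta/delta)] agree, so the
    inequality between integrals is scale invariant. *)
Lemma content_average_poweR_le delta beta : (0 < delta <= beta)%R ->
  (beta <= n%:R)%R -> exists2 C : R, (0 <= C)%R &
  forall c l f, (0 < l)%R -> (forall x, 0 <= f x) ->
    content_average beta (cube c l) (fun x => f x `^ (beta / delta)) <=
    C%:E * content_average delta (cube c l) f `^ (beta / delta).
Proof.
move=> db bn; have /andP[d0 le_db] := db; have b0 := lt_le_trans d0 le_db.
exists (((1 - (2 `^ (delta / beta))^-1)^-1) `^ (beta / delta))%R.
  exact: powR_ge0.
move=> c l f l0 f0; have dn := le_trans le_db bn.
rewrite (content_averageE _ _ b0 bn l0) (content_averageE _ _ d0 dn l0).
have Hoo : H beta (cube c l) < +oo by rewrite hausdorff_content_cube// ltry.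
apply: le_trans (lee_wpmul2l _ (choquet_integral_poweR_le db Hoo f0)) _.
  by rewrite lee_fin powR_ge0.
rewrite [leRHS]muleC poweRM ?choquet_integral_ge0 ?lee_fin ?powR_ge0//.
rewrite poweR_EFin -powRrM -muleA (_ : - delta * (beta / delta) = - beta)%R.
  by rewrite lee_wpmul2l ?lee_fin ?powR_ge0// muleC.
by field; rewrite gt_eqF.
Qed.

Lemma content_average_jensen delta r : (0 < delta)%R -> (delta <= n%:R)%R ->
  (1 <= r)%R -> exists2 C : R, (0 <= C)%R &
  forall c l f, (0 < l)%R -> (forall x, 0 <= f x) ->
    content_average delta (cube c l) f <=
    C%:E * content_average delta (cube c l) (fun x => f x `^ r) `^ r^-1.
Proof.
move=> d0 dn r1; have r0 : (0 < r)%R by rewrite (lt_le_trans ltr01).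
set C := (1 + (1 - (2 `^ r)^-1)^-1)%R.
have C0 : (0 < C)%R.
  rewrite ltr_wpDr// invr_ge0 subr_ge0 invf_le1 ?powR_gt0// ltW//.
  by rewrite powR_gt1// ltr1n.
exists C => [|c l f l0 f0]; first exact: ltW.
set Q := cube c l; set A := content_average delta Q (fun x => f x `^ r).
have A0 : 0 <= A by exact: content_average_ge0.
have [->|Aoo] := eqVneq A +oo.
  by rewrite poweRyr ?gt_eqF ?invr_gt0// gt0_muley ?leey ?lte_fin.
have Afin : A \is a fin_num by rewrite ge0_fin_numE// ltey.
set v := (fine A `^ r^-1)%R.
have -> : A `^ r^-1 = v%:E by rewrite -(fineK Afin) poweR_EFin.
have v0 : (0 <= v)%R by exact: powR_ge0.
have ld0 : (0 < l `^ delta)%R by rewrite powR_gt0.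
apply/lee_addgt0Pr => e e0.
(* [C * lam = C * v + e], and [lam] stays positive when [v = 0] *)
pose lam := (v + e / C)%R.
have lam0 : (0 < lam)%R by rewrite ltr_wpDl// divr_gt0.
have int_le : I delta Q (fun x => f x `^ r) <= (lam `^ r * l `^ delta)%:E.
  rewrite EFinM -lee_pdivrMr// muleC -powRN -content_averageE// -/A -(fineK Afin).
  rewrite lee_fin -[leLHS]powRr1 ?fine_ge0// -[X in (_ `^ X <=
    _)%R](@mulVf _ r) ?gt_eqF// powRrM.
  by rewrite ge0_ler_powR ?nnegrE ?(ltW lam0) ?(ltW r0)// lerDl ltW// divr_gt0.
have := choquet_integral_jensen r1 lam0 f0 (hausdorff_content_cube_le _ _ l0) int_le.
rewrite -/C EFinM -lee_pdivrMr// muleC -powRN -content_averageE// => /le_trans;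
  apply.
by rewrite -EFinM -EFinD lee_fin /lam mulrDr mulrCA divff ?mulr1// gt_eqF.
Qed.

Lemma poweR_inve r (x : \bar R) : (0 < r)%R -> 0 <= x -> (x^-1) `^ r = (x `^ r)^-1.
Proof.
move=> r0; case: x => [x|_|//]; last first.
  by rewrite invey poweR0r ?poweRyr ?invey// gt_eqF.
rewrite lee_fin le_eqVlt => /predU1P[<-|x0].
  by rewrite inve0 poweRyr ?poweR0r ?inve0// gt_eqF.
rewrite inver (gt_eqF x0) !poweR_EFin inver powR_eq0 (gt_eqF x0)/=.
by rewrite -powR_inv1 ?ltW// -powRrM mulN1r powRN.
Qed.

Lemma neg_power_ge0 w a x : 0 <= neg_power w a x.
Proof. by rewrite /neg_power inve_ge0 poweR_ge0. Qed.

Lemma neg_power_poweR w a r : (0 < r)%R ->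
  neg_power w (a * r) = (fun x => neg_power w a x `^ r).
Proof.
by move=> r0; apply/funext => x; rewrite /neg_power poweR_inve ?poweR_ge0// poweRrM.
Qed.

Lemma ler_coord_norm (x : 'rV[R]_n) i : (`|x ord0 i| <= `|x|)%R.
Proof.
have /mapP[j Hj ->] : (`|x ord0 i| \in [seq `|x y.1 y.2| | y : 'I_1 * 'I_n])%R.
  by apply/mapP; exists (ord0, i) => //=; rewrite mem_enum.
by rewrite [leRHS]/Num.norm /= mx_normrE; apply/bigmax_geP; right => /=; exists j.
Qed.

Lemma norm_le_coord (x : 'rV[R]_n) r : (0 <= r)%R ->
  (forall i, `|x ord0 i| <= r)%R -> (`|x| <= r)%R.
Proof.
move=> r0 xr; rewrite /Num.norm/= mx_normrE; apply/bigmax_leP; split => // -[i j] _.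
by rewrite /= (ord1 i).
Qed.

Lemma ball_sub_cube r :
  [set x : 'rV[R]_n | (`|x| < r)%R] `<=` cube (const_mx (- r)%R) (2 * r)%R.
Proof.
move=> x /= xr i; have := le_lt_trans (ler_coord_norm x i) xr.
rewrite mxE ltr_norml => /andP[-> /ltW]/=; lra.
Qed.

Lemma compact_sub_ball E : compact E ->
  exists2 r : R, (0 < r)%R & E `<=` [set x | (`|x| < r)%R].
Proof.
move=> /compact_bounded[M [_ EM]]; exists (`|M| + 2)%R.
  by rewrite ltr_wpDl.
move=> x Ex /=; apply: (@le_lt_trans _ _ (`|M| + 1)%R); last by
  rewrite ltrD2l ltr1n.
by apply: (EM (`|M| + 1)%R) => //; rewrite (le_lt_trans (ler_norm M))// ltrDl.
Qed.

Lemma capacitary_weight_le delta beta w : (0 < delta <= beta)%R ->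
  capacitary_weight delta w -> capacitary_weight beta w.
Proof.
move=> db [w0 wint [N N0 wN]]; split; first exact: w0.
  move=> E cE; have [r r0 Er] := compact_sub_ball cE.
  have r20 : (0 < 2 * r)%R by rewrite mulr_gt0.
  have Ecube : E `<=` cube (const_mx (- r)%R) (2 * r)%R.
    by move=> x /Er; exact: ball_sub_cube.
  have HI := choquet_integral_le_cube w db r20 Ecube.
  apply: le_lt_trans HI _.
  apply: lte_mul_pinfty; [by rewrite lee_fin powR_ge0|by []|exact: wint].
by exists N; [exact: hausdorff_content_eq0 N0|exact: wN].
Qed.

Lemma A1_class_le delta beta : (0 < delta <= beta)%R -> (beta <= n%:R)%R ->
  A1_class n delta `<=` @A1_class R n beta.
Proof.
move=> db bn w [cw Aw]; split; first exact: capacitary_weight_le cw.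
apply: le_lt_trans Aw; apply: ereal_inf_le_tmp => _ [K [K0 [N N0 MN]] <-].
exists K; last by [].
split; first exact: K0.
exists N; first exact: hausdorff_content_eq0 N0.
move=> x /MN; apply: le_trans; apply: ge_ereal_sup => _ [_ [[c [l [l0 ->]]] xQ] <-].
apply: le_trans (content_average_le _ _ db bn l0) _.
by apply: ereal_sup_ubound; exists (cube c l) => //; split => //; exists c, l.
Qed.

Lemma Ap_constant_le p q delta beta w (C : R) : (0 <= C)%R ->
  (forall c l, (0 < l)%R ->
    content_average beta (cube c l) w *
      content_average beta (cube c l) (neg_power w (q - 1)^-1%R) `^ (q - 1) <=
    C%:E * (content_average delta (cube c l) w *
      content_average delta (cube c l) (neg_power w (p - 1)^-1%R) `^ (p - 1))) ->
  Ap_constant q beta w <= C%:E * Ap_constant p delta w.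
Proof.
move=> C0 le_C; apply: ge_ereal_sup => _ [_ [c [l [l0 ->]]] <-].
apply: le_trans (le_C c l l0) _; rewrite lee_wpmul2l//.
by apply: ereal_sup_ubound; exists (cube c l) => //; exists c, l.
Qed.

(** The exponents match because [(q - 1)^-1 = (p - 1)^-1 * (beta / delta)]. *)
Lemma Ap_class_le_dim p delta beta : (1 < p)%R -> (0 < delta <= beta)%R ->
  (beta <= n%:R)%R ->
  Ap_class n p delta `<=` @Ap_class R n ((p * delta + beta - delta) / beta) beta.
Proof.
move=> p1 db bn w [cw Aw]; have /andP[d0 le_db] := db.
have b0 := lt_le_trans d0 le_db; have dn := le_trans le_db bn.
split; first exact: capacitary_weight_le cw.
set q := (_ / _)%R; set r := (beta / delta)%R.
have p10 : (0 < p - 1)%R by rewrite subr_gt0.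
have r0 : (0 < r)%R by rewrite divr_gt0.
have qE : (q - 1 = (p - 1) / r)%R by rewrite /q /r; field; rewrite !gt_eqF.
have [C C0 HC] := content_average_poweR_le db bn.
have q10 : (0 < q - 1)%R by rewrite qE divr_gt0.
apply: le_lt_trans (@Ap_constant_le p q delta beta w (C `^ (q - 1)) (powR_ge0 _ _) _) _.
  move=> c l l0; rewrite muleCA; apply: lee_pmul.
  - exact: content_average_ge0.
  - exact: poweR_ge0.
  - exact: content_average_le.
  have -> : ((q - 1)^-1 = (p - 1)^-1 * r)%R by rewrite qE invf_div mulrC.
  rewrite neg_power_poweR//.
  apply: le_trans (ge0_le_poweR (ltW q10) (content_average_ge0 _ _ _)
    (HC c l _ l0 (neg_power_ge0 w (p - 1)^-1))) _.
  rewrite poweRM ?poweR_ge0 ?lee_fin//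
    poweR_EFin -poweRrM -/r qE mulrCA divff ?mulr1//.
  by rewrite gt_eqF.
by apply: lte_mul_pinfty => //; rewrite lee_fin powR_ge0.
Qed.

(** Jensen's inequality with exponent [(p - 1) / (q - 1)]. *)
Lemma Ap_class_le_exp p q delta : (1 < q <= p)%R -> (0 < delta)%R ->
  (delta <= n%:R)%R -> Ap_class n q delta `<=` @Ap_class R n p delta.
Proof.
move=> /andP[q1 qp] d0 dn w [cw Aw]; split => //.
have q10 : (0 < q - 1)%R by rewrite subr_gt0.
have p10 : (0 < p - 1)%R by rewrite subr_gt0 (lt_le_trans q1).
set r := ((p - 1) / (q - 1))%R.
have r0 : (0 < r)%R by rewrite divr_gt0.
have r1 : (1 <= r)%R by rewrite ler_pdivlMr// mul1r lerD2r.
have [C C0 HC] := content_average_jensen d0 dn r1.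
apply: le_lt_trans (@Ap_constant_le q p delta delta w (C `^ (p - 1)) (powR_ge0 _ _) _) _.
  move=> c l l0; rewrite muleCA lee_wpmul2l ?content_average_ge0//.
  have -> : ((q - 1)^-1 = (p - 1)^-1 * r)%R.
    by rewrite /r; field; rewrite !gt_eqF.
  rewrite neg_power_poweR//.
  apply: le_trans (ge0_le_poweR (ltW p10) (content_average_ge0 _ _ _)
    (HC c l _ l0 (neg_power_ge0 w (p - 1)^-1))) _.
  rewrite poweRM ?poweR_ge0 ?lee_fin// poweR_EFin -poweRrM.
  by rewrite (_ : r^-1 * (p - 1) = q - 1)%R// /r; field; rewrite !gt_eqF.
by apply: lte_mul_pinfty => //; rewrite lee_fin powR_ge0.
Qed.

End averages.

(** * Negative powers of the norm *)

Section power_weights.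
Context {R : realType} {n : nat}.
Local Open Scope ereal_scope.
Implicit Types (E F : set 'rV[R]_n) (f g u w : 'rV[R]_n -> \bar R).
Implicit Types (delta beta gamma alpha r s a p q l : R) (c x : 'rV[R]_n).
Local Notation H := hausdorff_content.
Local Notation I := choquet_integral.

(** The weight |x|^(-gamma), for the maximum norm; its value at the origin is
    [+oo]. *)
Definition singular_weight gamma : 'rV[R]_n -> \bar R :=
  fun x => ((`|x| `^ gamma)%:E)^-1.

Lemma singular_weight_ge0 gamma x : 0 <= singular_weight gamma x.
Proof. by rewrite inve_ge0 lee_fin powR_ge0. Qed.

Lemma singular_weight_gt gamma rho x : (0 < gamma)%R -> (0 < rho)%R ->
  (((rho `^ gamma)^-1)%:E < singular_weight gamma x) = (`|x| < rho)%R.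
Proof.
move=> g0 rho0; have rg0 : (0 < rho `^ gamma)%R by rewrite powR_gt0.
have -> : ((rho `^ gamma)^-1)%:E = ((rho `^ gamma)%:E)^-1.
  by rewrite inver (gt_eqF rg0).
rewrite lte_pV2 ?inE ?lee_fin ?powR_ge0// lte_fin; apply/idP/idP.
  by apply: contraTT; rewrite -!leNgt => ?; rewrite ge0_ler_powR ?nnegrE// ltW.
by move=> xrho; rewrite gt0_ltr_powR ?nnegrE// ltW.
Qed.

Lemma nneseries_geometric_le (b z : R) : (0 <= b)%R -> (0 < z < 1)%R ->
  \sum_(k <oo) (b * z ^+ k)%:E <= (b / (1 - z))%:E.
Proof.
move=> b0 /andP[z0 z1]; apply: lime_le.
  by apply: is_cvg_nneseries => k _ _; rewrite lee_fin mulr_ge0// exprn_ge0// ltW.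
apply: nearW => k; rewrite sumEFin lee_fin.
by apply: geometric_le_lim => //; rewrite gtr0_norm.
Qed.

Lemma powR_exprVn (b r : R) k : (0 <= b)%R ->
  ((b ^- k) `^ r = (b `^ (- r)) ^+ k)%R.
Proof.
move=> b0; rewrite -powR_invn// -(powR_mulrn k (powR_ge0 b (- r))) -!powRrM.
by congr (_ `^ _)%R; ring.
Qed.

(** The level sets along the progression of ratio [2^gamma] started at
    [l^(-gamma)] lie in the balls of radius [l 2^(-k)], of content at most
    [(2 l 2^(-k))^beta]; the sum is a geometric series of ratio [2^(gamma -
    beta) < 1]. *)
Lemma singular_weight_near gamma beta c l E : (0 < gamma < beta)%R -> (0 < l)%R ->
  E `<=` cube c l ->
  I beta E (singular_weight gamma) <=
  ((l `^ gamma)^-1 * l `^ beta *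
    (1 + (2 `^ gamma - 1) * (2 `^ beta / (1 - 2 `^ (gamma - beta)))))%:E.
Proof.
move=> /andP[g0 gb] l0 Ecl; have b0 := lt_trans g0 gb.
have s0 : (0 < (l `^ gamma)^-1)%R by rewrite invr_gt0 powR_gt0.
have a1 : (1 < 2 `^ gamma :> R)%R by rewrite powR_gt1// ltr1n.
apply: le_trans (choquet_geometric_le _ _ _ s0 a1) _.
rewrite [leRHS](_ : _ = ((l `^ gamma)^-1 * l `^ beta)%:E +
    ((l `^ gamma)^-1 * l `^ beta * ((2 `^ gamma - 1) *
      (2 `^ beta / (1 - 2 `^ (gamma - beta)))))%:E); last first.
  by rewrite mulrDr mulr1 EFinD.
apply: leeD.
  rewrite EFinM lee_wpmul2l ?lee_fin ?(ltW s0)//.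
  exact: le_trans (le_hausdorff_content _ Ecl) (hausdorff_content_cube_le _ _ l0).
rewrite mulrCA EFinM lee_wpmul2l ?lee_fin ?subr_ge0 ?(ltW a1)//.
have z01 : (0 < 2 `^ (gamma - beta) < (1 : R))%R.
  rewrite powR_gt0//= -opprB powRN invf_lt1 ?powR_gt0//.
  by rewrite powR_gt1 ?ltr1n// subr_gt0.
rewrite mulrA; apply: le_trans (nneseries_geometric_le _ z01); last first.
  by rewrite !mulr_ge0 ?powR_ge0// ltW.
apply: lee_nneseries => [k _ _|k _].
  rewrite mule_ge0 ?level_content_ge0// lee_fin.
  by rewrite mulr_ge0 ?exprn_ge0 ?powR_ge0// ltW.
have rho0 : (0 < l * 2 ^- k)%R by rewrite mulr_gt0// invr_gt0 exprn_gt0.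
have levelE : ((l `^ gamma)^-1 * 2 `^ gamma ^+ k = ((l * 2 ^- k) `^ gamma)^-1)%R.
  rewrite powRM ?invr_ge0 ?exprn_ge0 ?(ltW l0)// invfM; congr (_ * _)%R.
  by rewrite powR_exprVn// powRN exprVn invrK.
have lev : level_content beta E (singular_weight gamma) ((l `^ gamma)^-1 * 2 `^ gamma ^+ k)
    <= ((2 * (l * 2 ^- k)) `^ beta)%:E.
  apply: (@le_trans _ _ (H beta (cube (const_mx (- (l * 2 ^- k))%R : 'rV[R]_n)
      (2 * (l * 2 ^- k))%R))).
    apply: le_hausdorff_content => x [_ /=]; rewrite levelE singular_weight_gt//.
    exact: ball_sub_cube.
  by apply: hausdorff_content_cube_le; rewrite mulr_gt0.
apply: le_trans (lee_wpmul2l _ lev) _.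
  by rewrite lee_fin mulr_ge0 ?exprn_ge0 ?powR_ge0// ltW.
rewrite -EFinM lee_fin !powRM ?mulr_ge0 ?invr_ge0 ?exprn_ge0 ?(ltW l0)//.
rewrite powR_exprVn// powRD ?pnatr_eq0 ?implybT// exprMn le_eqVlt; apply/orP;
  left; apply/eqP.
ring.
Qed.

Lemma cube_norm_le c l x y : (0 < l)%R -> cube c l x -> cube c l y ->
  (`|x - y| <= l)%R.
Proof.
move=> l0 xc yc; apply: norm_le_coord; first exact: ltW.
move=> i; rewrite !mxE ler_norml.
have /andP[] := xc i; have /andP[] := yc i; lra.
Qed.

(** If the norm of [x] is less than [2 l], the average is at most a multiple of
    [l^(-gamma)], hence of the weight at [x]. Otherwise all points of the
    cube have norm at least half of that of [x], and the weight is
    essentially constant on the cube. *)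
Lemma singular_weight_A1 gamma beta : (0 < gamma < beta)%R -> (beta <= n%:R)%R ->
  exists2 C : R, (0 < C)%R & forall c l x, (0 < l)%R -> cube c l x ->
    content_average beta (cube c l) (singular_weight gamma) <=
    C%:E * singular_weight gamma x.
Proof.
move=> gb bn; have /andP[g0 lt_gb] := gb; have b0 := lt_trans g0 lt_gb.
set K := (1 + (2 `^ gamma - 1) * (2 `^ beta / (1 - 2 `^ (gamma - beta))) : R)%R.
have K1 : (1 <= K)%R.
  rewrite lerDl mulr_ge0 ?divr_ge0 ?powR_ge0// subr_ge0.
    by rewrite ltW// powR_gt1// ltr1n.
  by rewrite -opprB powRN invf_le1 ?powR_gt0// ltW// powR_gt1 ?ltr1n// subr_gt0.
have K0 : (0 < K)%R by rewrite (lt_le_trans ltr01).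
have g2 : (0 < 2 `^ gamma :> R)%R by rewrite powR_gt0.
exists (2 `^ gamma * K)%R => [|c l x l0 xQ]; first by rewrite mulr_gt0.
rewrite (content_averageE _ _ b0 bn l0).
have lb0 : (0 < l `^ beta)%R by rewrite powR_gt0.
have [xl|lx] := ltP `|x|%R (2 * l)%R.
  apply: le_trans (lee_wpmul2l _ (singular_weight_near gb l0 (@subset_refl _ _))) _.
    by rewrite lee_fin powR_ge0.
  have l20 : (0 < 2 * l)%R by rewrite mulr_gt0.
  have vx : (((2 * l) `^ gamma)^-1)%:E < singular_weight gamma x.
    by rewrite singular_weight_gt.
  have CK0 : 0 <= (2 `^ gamma * K)%:E by rewrite lee_fin ltW// mulr_gt0.
  apply: le_trans (lee_wpmul2l CK0 (ltW vx)).
  rewrite -EFinM -EFinM lee_fin -/K powRM ?(ltW l0)// powRN.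
  rewrite le_eqVlt; apply/orP; left; apply/eqP.
  by field; rewrite ?gt_eqF// powR_gt0.
have x0 : (0 < `|x|)%R by rewrite (lt_le_trans _ lx)// mulr_gt0.
have xg0 : (0 < `|x| `^ gamma)%R by rewrite powR_gt0.
pose M := (2 `^ gamma * (`|x| `^ gamma)^-1)%R.
have M0 : (0 < M)%R by rewrite mulr_gt0// invr_gt0.
have vM y : cube c l y -> singular_weight gamma y <= M%:E.
  move=> yQ; have := cube_norm_le l0 xQ yQ.
  have := lerB_dist x y => xy1 xy2.
  have yx : (`|x| / 2 <= `|y|)%R by lra.
  have x20 : (0 < `|x| / 2)%R by rewrite divr_gt0.
  rewrite leNgt; have -> : M = ((`|x| / 2) `^ gamma)^-1%R.
    rewrite /M powRM ?(ltW x0) ?invr_ge0// -[X in (_ * X `^ _)%R]powR_inv1// -powRrM.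
    by rewrite mulN1r powRN invfM invrK mulrC.
  by rewrite singular_weight_gt// -leNgt.
have HI := choquet_integral_bounded beta M0 vM.
apply: le_trans (lee_wpmul2l _ HI) _; first by rewrite lee_fin powR_ge0.
rewrite (hausdorff_content_cube _ b0 bn l0) /singular_weight inver (gt_eqF xg0).
rewrite -!EFinM lee_fin powRN mulrCA mulVf ?(gt_eqF lb0)// mulr1 /M.
by rewrite -mulrA ler_pM2l// ler_peMl// invr_ge0 ltW.
Qed.

(** The duality between an A_1-type bound and the A_p product: with [A] the
    average of [f], the bound [A <= C * f x] gives [g x ^ s <= C / A] on
    [Q], hence also for the average of [g]. If [A = 0] the product is 0; if
    [A = +oo] then [g] vanishes on [Q] and the product is again 0. *)
Lemma average_product_le delta Q f g s (C : R) :
  (0 < delta)%R -> (delta <= n%:R)%R -> cubes Q -> (0 < C)%R -> (0 < s)%R ->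
  (forall x, 0 <= f x) -> (forall x, 0 <= g x) ->
  (forall x, Q x -> content_average delta Q f <= C%:E * f x) ->
  (forall x, Q x -> g x `^ s <= (f x)^-1) ->
  content_average delta Q f * content_average delta Q g `^ s <= C%:E.
Proof.
move=> d0 dn [c [l [l0 QE]]] C0 s0 f0 g0 fA gf.
set A := content_average delta Q f.
have A0 : 0 <= A by exact: content_average_ge0.
have [->|An0] := eqVneq A 0; first by rewrite mul0e lee_fin ltW.
have Agt0 : 0 < A by rewrite lt_neqAle eq_sym An0.
have ld0 : (0 < l `^ delta)%R by rewrite powR_gt0.
pose B := (C%:E / A) `^ s^-1.
have fB x : Q x -> g x <= B.
  move=> Qx; rewrite -[leLHS]poweRe1// -(@mulfV _ s) ?gt_eqF// poweRrM.
  apply: ge0_le_poweR; [by rewrite invr_ge0 ltW|exact: poweR_ge0|].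
  apply: le_trans (gf _ Qx) _; have := fA _ Qx; rewrite -/A.
  rewrite -lee_pdivrMl// => AC.
  have -> : C%:E / A = ((C^-1)%:E * A)^-1.
    rewrite (@inveM _ (C^-1)%:E A); last first.
      rewrite inveM_defE eqe invr_eq0 (gt_eqF C0) (negPf An0) Agt0 lte_fin.
      by rewrite invr_gt0 C0 !implybT.
    by rewrite inver invr_eq0 (gt_eqF C0) invrK.
  have CA0 : 0 <= (C^-1)%:E * A by rewrite mule_ge0// lee_fin invr_ge0 ltW.
  by rewrite lee_pV2 ?inE.
have sV0 : (s^-1 != 0)%R by rewrite gt_eqF ?invr_gt0.
have avg_g : content_average delta Q g <= B.
  (* if [A = +oo] then [g] vanishes on [Q] *)
  have [Ay|Ay] := eqVneq A +oo.
    have B0 : B = 0 by rewrite /B Ay invey mule0 poweR0r.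
    rewrite B0 /content_average (_ : I delta Q g = 0) ?mule0//.
    apply/eqP; rewrite eq_le choquet_integral_ge0 andbT.
    apply/lee_addgt0Pr => e e0; rewrite add0e.
    have e1 : (0 < e / l `^ delta)%R by rewrite divr_gt0.
    apply: le_trans (choquet_integral_bounded delta e1 _) _.
      by move=> x Qx; rewrite (le_trans (fB _ Qx))// B0 lee_fin ltW.
    by rewrite QE (hausdorff_content_cube _ d0 dn l0) -EFinM divfK// gt_eqF.
  have Afin : A \is a fin_num by rewrite ge0_fin_numE// ltey.
  have AV : A^-1 = ((fine A)^-1)%:E.
    by rewrite -[in LHS](fineK Afin) inver fine_eq0// (negPf An0).
  have fA0 : (0 < fine A)%R by rewrite fine_gt0// Agt0 ltey.
  pose b := ((C / fine A) `^ s^-1)%R.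
  have Bb : B = b%:E by rewrite /B AV -EFinM poweR_EFin.
  have b0 : (0 < b)%R by rewrite powR_gt0// divr_gt0.
  rewrite {1}QE (content_averageE _ _ d0 dn l0) Bb.
  have bQ x : cube c l x -> g x <= b%:E by rewrite -QE -Bb; exact: fB.
  apply: le_trans (lee_wpmul2l _ (choquet_integral_bounded delta b0 bQ)) _.
    by rewrite lee_fin powR_ge0.
  rewrite (hausdorff_content_cube _ d0 dn l0) -!EFinM lee_fin powRN mulrCA.
  by rewrite mulVf ?mulr1// gt_eqF.
apply: (@le_trans _ _ (A * B `^ s)).
  by rewrite lee_wpmul2l// ge0_le_poweR ?content_average_ge0// ltW.
rewrite /B -poweRrM mulVf ?(gt_eqF s0)// poweRe1; last first.
  by rewrite mule_ge0 ?inve_ge0// lee_fin ltW.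
have [Ay|Ay] := eqVneq A +oo.
  by rewrite Ay invey !mule0 lee_fin ltW.
have Afin : A \is a fin_num by rewrite ge0_fin_numE// ltey.
by rewrite muleCA (muleC A) mulVe ?mule1.
Qed.

End power_weights.

(** * Weights that separate the classes *)

Section strictness.
Context {R : realType} {n : nat}.
Local Open Scope ereal_scope.
Implicit Types (E F : set 'rV[R]_n) (f g u w : 'rV[R]_n -> \bar R).
Implicit Types (delta beta gamma alpha r s a p q l : R) (c x : 'rV[R]_n).
Local Notation H := hausdorff_content.
Local Notation I := choquet_integral.

(** Single points are null, being contained in cubes of arbitrarily small edge.
    *)
Lemma hausdorff_content_origin delta : (0 < delta)%R ->
  H delta [set 0%R : 'rV[R]_n] = 0.
Proof.
move=> d0; apply/eqP; rewrite eq_le hausdorff_content_ge0 andbT.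
apply/lee_addgt0Pr => e e0; rewrite add0e.
have e1 : (0 < e `^ delta^-1)%R by rewrite powR_gt0.
have := @hausdorff_content_cube_le R n delta (const_mx (- (e `^ delta^-1 / 2))%R)
  (2 * (e `^ delta^-1 / 2))%R.
rewrite [(2 * _)%R]mulrC divfK// -powRrM mulVf ?(gt_eqF d0)// powRr1 ?(ltW e0)//.
move=> /(_ e1); apply: le_trans; apply: le_hausdorff_content => _ ->.
have := @ball_sub_cube R n (e `^ delta^-1 / 2)%R 0%R.
by rewrite /= normr0 [(2 * _)%R]mulrC divfK//; apply; rewrite divr_gt0.
Qed.

Lemma content_ae_off_origin delta (P : 'rV[R]_n -> Prop) : (0 < delta)%R ->
  (forall x, (0 < `|x|)%R -> P x) -> content_ae delta P.
Proof.
move=> d0 P0; exists [set 0%R]; first exact: hausdorff_content_origin.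
by move=> x /= x0; apply: P0; rewrite normr_gt0; apply/eqP.
Qed.

Lemma singular_weight_capacitary gamma beta : (0 < gamma < beta)%R ->
  capacitary_weight beta (@singular_weight R n gamma).
Proof.
move=> gb; have /andP[g0 lt_gb] := gb; have b0 := lt_trans g0 lt_gb.
split; first by move=> x; exact: singular_weight_ge0.
  move=> E /compact_sub_ball[r r0 Er].
  have r20 : (0 < 2 * r)%R by rewrite mulr_gt0.
  have Ecube : E `<=` cube (const_mx (- r)%R) (2 * r)%R.
    by move=> x /Er; exact: ball_sub_cube.
  by apply: le_lt_trans (singular_weight_near gb r20 Ecube) _; rewrite ltry.
apply: content_ae_off_origin => // x x0.
rewrite /singular_weight inver gt_eqF ?powR_gt0// ltry andbT lte_fin.
by rewrite invr_gt0 powR_gt0.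
Qed.

Lemma singular_weight_A1_class gamma beta : (0 < gamma < beta)%R ->
  (beta <= n%:R)%R -> A1_class n beta (@singular_weight R n gamma).
Proof.
move=> gb bn; split; first exact: singular_weight_capacitary.
have [C C0 HC] := singular_weight_A1 gb bn.
apply: (@le_lt_trans _ _ C%:E); last by rewrite ltry.
apply: ereal_inf_lbound; exists C; last by [].
split; first exact: C0.
exists set0; first exact: hausdorff_content0.
move=> x _; apply: ge_ereal_sup => _ [_ [[c [l [l0 ->]]] xQ] <-].
have -> : (fun y => `|singular_weight gamma y|) = @singular_weight R n gamma.
  by apply/funext => y; rewrite gee0_abs// singular_weight_ge0.
exact: HC.
Qed.

Lemma singular_weight_Ap_class gamma beta q : (0 < gamma < beta)%R ->
  (beta <= n%:R)%R -> (1 < q)%R -> Ap_class n q beta (@singular_weight R n gamma).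
Proof.
move=> gb bn q1; have /andP[g0 lt_gb] := gb; have b0 := lt_trans g0 lt_gb.
split; first exact: singular_weight_capacitary.
have [C C0 HC] := singular_weight_A1 gb bn.
have q10 : (0 < q - 1)%R by rewrite subr_gt0.
apply: (@le_lt_trans _ _ C%:E); last by rewrite ltry.
apply: ge_ereal_sup => _ [Q Qcube <-]; have [c [l [l0 QE]]] := Qcube.
apply: (average_product_le b0 bn Qcube C0 q10).
- exact: singular_weight_ge0.
- exact: neg_power_ge0.
- by move=> x; rewrite QE => xQ; exact: HC.
move=> x _; rewrite -[_ `^ _]/((fun y => neg_power _ _ y `^ _) x) -neg_power_poweR//.
by rewrite mulVf ?gt_eqF// /neg_power poweRe1// singular_weight_ge0.
Qed.

(** Along the progression [2^(beta k)], the level sets contain cubes of edge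
    [2^(-k-1)], so every term of the sum is at least [2^(-beta)]. *)
Lemma singular_weight_choquet beta : (0 < beta)%R -> (beta <= n%:R)%R ->
  I beta (cube 0 1%R) (@singular_weight R n beta) = +oo.
Proof.
move=> b0 bn; apply/eqP; apply: contraT => Ioo.
set J := I _ _ _ in Ioo.
have J0 : 0 <= J by exact: choquet_integral_ge0.
have Jfin : J \is a fin_num by rewrite ge0_fin_numE// ltey.
have a1 : (1 < 2 `^ beta :> R)%R by rewrite powR_gt1// ltr1n.
set K := ((1 - (2 `^ beta)^-1)^-1 : R)%R.
pose b := (2 `^ (- beta) : R)%R.
have b_gt0 : (0 < b)%R by rewrite powR_gt0.
have rho0 k : (0 < 2 ^- k :> R)%R by rewrite invr_gt0 exprn_gt0.
have term k : b%:E <= (1 * 2 `^ beta ^+ k)%:E *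
    level_content beta (cube 0 1%R) (@singular_weight R n beta) (1 * 2 `^ beta ^+ k).
  have levelE : (1 * 2 `^ beta ^+ k = ((2 ^- k) `^ beta)^-1 :> R)%R.
    by rewrite mul1r powR_exprVn// powRN exprVn invrK.
  have sub : cube (0 : 'rV[R]_n) (2 ^- k.+1)%R `<=` cube 0 1%R `&`
      [set x | (1 * 2 `^ beta ^+ k)%:E < singular_weight beta x].
    have le21 : (2 ^- k.+1 < 2 ^- k :> R)%R.
      by rewrite ltf_pV2 ?posrE ?exprn_gt0// exprS ltr_pMl ?exprn_gt0// ltr1n.
    have le1 : (2 ^- k.+1 <= 1 :> R)%R by rewrite invf_le1 ?exprn_gt0// exprn_ege1// ler1n.
    move=> x xk; split.
      move=> i; have := xk i; rewrite !mxE => /andP[-> xi] /=.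
      by rewrite (le_trans xi)// lerD2l.
    rewrite /= levelE singular_weight_gt//; apply: le_lt_trans le21.
    apply: norm_le_coord; first exact: ltW.
    by move=> i; have := xk i; rewrite !mxE add0r => /andP[xi ?]; rewrite gtr0_norm.
  have := le_hausdorff_content beta sub.
  rewrite (hausdorff_content_cube _ b0 bn (rho0 _)) => le_lev.
  apply: le_trans (lee_wpmul2l _ le_lev); last first.
    by rewrite lee_fin mul1r exprn_ge0// powR_ge0.
  rewrite -EFinM lee_fin mul1r powR_exprVn// -/b exprS mulrCA -exprMn.
  rewrite -powRD ?pnatr_eq0 ?implybT// subrr powRr0 expr1n mulr1//.
have le_N N : (N%:R * b)%:E <= K%:E * J.
  apply: le_trans (choquet_geometric_ge _ _ _ ltr01 a1).
  apply: le_trans (nneseries_lim_ge N _); last first.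
    by move=> k _ _; apply: le_trans (term k); rewrite lee_fin ltW.
  rewrite (_ : (N%:R * b)%:E = \sum_(0 <= k < N) b%:E).
    by apply: lee_sum => k _; exact: term.
  by rewrite sumEFin sumr_const_nat subn0 mulr_natl.
move: (le_N (Num.truncn (K * fine J / b)).+1).
rewrite -(fineK Jfin) -EFinM lee_fin -ler_pdivlMr// leNgt.
by rewrite truncnS_gt.
Qed.

Lemma cube01_compact : exists2 E : set 'rV[R]_n, compact E & cube 0 1%R `<=` E.
Proof.
exists [set x : 'rV[R]_n | forall i, `[0%R, 1%R]%classic (x ord0 i)].
  apply: (@rV_compact R n (fun=> `[0%R, 1%R]%classic)) => i.
  exact: segment_compact.
move=> x x01 i; have := x01 i; rewrite /= !mxE add0r in_itv/= => /andP[/ltW -> ->].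
by [].
Qed.

Lemma singular_weight_not_capacitary beta : (0 < beta)%R -> (beta <= n%:R)%R ->
  ~ capacitary_weight beta (@singular_weight R n beta).
Proof.
move=> b0 bn [_ int_lty _]; have [E cE subE] := cube01_compact.
have := le_choquet_integral beta subE (fun x _ => lexx (singular_weight beta x)).
by rewrite singular_weight_choquet// leye_eq => /eqP Eoo; have := int_lty _ cE;
  rewrite Eoo.
Qed.

Definition power_weight alpha : 'rV[R]_n -> \bar R := fun x => (`|x| `^ alpha)%:E.

Lemma neg_power_power_weight alpha a :
  neg_power (power_weight alpha) a = singular_weight (alpha * a).
Proof.
by apply/funext => x; rewrite /neg_power /power_weight poweR_EFin -powRrM.
Qed.

Lemma power_weight_capacitary alpha beta : (0 < alpha)%R -> (0 < beta)%R ->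
  capacitary_weight beta (power_weight alpha).
Proof.
move=> a0 b0; split; first by move=> x; rewrite lee_fin powR_ge0.
  move=> E /compact_sub_ball[r r0 Er].
  have r20 : (0 < 2 * r)%R by rewrite mulr_gt0.
  have ra0 : (0 < r `^ alpha)%R by rewrite powR_gt0.
  have Ebound x : E x -> power_weight alpha x <= (r `^ alpha)%:E.
    move=> /Er/= xr; rewrite lee_fin ge0_ler_powR ?nnegrE//; exact: ltW.
  apply: le_lt_trans (choquet_integral_bounded beta ra0 Ebound) _.
  apply: lte_mul_pinfty; [by rewrite lee_fin ltW|by []|].
  apply: (@le_lt_trans _ _ ((2 * r) `^ beta)%:E); last by rewrite ltry.
  apply: le_trans (hausdorff_content_cube_le beta (const_mx (- r)%R) r20).
  by apply: le_hausdorff_content => x /Er; exact: ball_sub_cube.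
apply: content_ae_off_origin => // x x0.
by rewrite /power_weight lte_fin powR_gt0//= ltry.
Qed.

(** Apply [average_product_le] to the dual weight |x|^(-alpha/(p-1)), which
    satisfies the A_1-type bound, and raise the result to the power [p - 1].
    *)
Lemma power_weight_Ap_class alpha beta p : (1 < p)%R ->
  (0 < alpha < beta * (p - 1))%R -> (beta <= n%:R)%R ->
  Ap_class n p beta (power_weight alpha).
Proof.
move=> p1 /andP[a0 ab] bn; have p10 : (0 < p - 1)%R by rewrite subr_gt0.
have gb : (0 < alpha * (p - 1)^-1 < beta)%R by rewrite divr_gt0//= ltr_pdivrMr.
have /andP[g0 lt_gb] := gb; have b0 := lt_trans g0 lt_gb.
split; first exact: power_weight_capacitary.
have [C C0 HC] := singular_weight_A1 gb bn.
have s0 : (0 < (p - 1)^-1)%R by rewrite invr_gt0.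
apply: (@le_lt_trans _ _ (C `^ (p - 1))%:E); last by rewrite ltry.
apply: ge_ereal_sup => _ [Q Qcube <-]; have [c [l [l0 QE]]] := Qcube.
rewrite neg_power_power_weight; set g := (alpha * _)%R in gb HC *.
have W0 x : 0 <= power_weight alpha x by rewrite lee_fin powR_ge0.
have QC x : Q x -> content_average beta Q (singular_weight g) <=
  C%:E * singular_weight g x.
  by rewrite QE => xQ; exact: HC.
have dual x : Q x -> power_weight alpha x `^ (p - 1)^-1 <= (singular_weight g x)^-1.
  by move=> _; rewrite /power_weight poweR_EFin -powRrM inveK.
have := average_product_le b0 bn Qcube C0 s0 (@singular_weight_ge0 R n g) W0 QC dual.
have A0 f : 0 <= content_average beta Q f by exact: content_average_ge0.
move=> /(ge0_le_poweR (ltW p10)); rewrite mule_ge0 ?poweR_ge0// => /(_ isT).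
rewrite (poweRM _ (A0 _) (poweR_ge0 _ _)) -poweRrM mulVf ?gt_eqF//.
by rewrite (poweRe1 (A0 _)) muleC poweR_EFin.
Qed.

(** On the unit cube with a corner at the origin the dual average is infinite
    and the average of the weight itself is positive. *)
Lemma power_weight_not_Ap beta q : (0 < beta)%R -> (beta <= n%:R)%R -> (1 < q)%R ->
  ~ Ap_class n q beta (power_weight (beta * (q - 1))).
Proof.
move=> b0 bn q1 [_]; apply/negP; rewrite -leNgt leye_eq.
have q10 : (0 < q - 1)%R by rewrite subr_gt0.
have n0 : (0 < n)%N by rewrite -(ltr_nat R) (lt_le_trans b0).
set Q := cube (0 : 'rV[R]_n) 1%R; set W := power_weight _.
rewrite eq_le leey/=.
have cQ : cubes Q by exists 0%R, 1%R; split.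
apply: le_trans (ereal_sup_ubound (_ : [set _ | _ in _] (content_average beta Q W *
  content_average beta Q (neg_power W (q - 1)^-1%R) `^ (q - 1)))); last by exists Q.
rewrite neg_power_power_weight mulfK ?gt_eqF// !(content_averageE _ _ b0 bn ltr01).
rewrite powR1 !mul1e singular_weight_choquet// poweRyr ?gt_eqF//.
suff : 0 < I beta Q W by move=> /gt0_muley ->.
have h0 : (0 < 2^-1 :> R)%R by rewrite invr_gt0.
have t0 : (0 < 2^-1 `^ (beta * (q - 1)) :> R)%R by rewrite powR_gt0.
have sub : cube (const_mx 2^-1%R : 'rV[R]_n) (2^-1)%R `<=`
    Q `&` [set x | (2^-1 `^ (beta * (q - 1)))%:E < W x].
  move=> x xh; split.
    by move=> i; have := xh i; rewrite !mxE; lra.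
  rewrite /= lte_fin gt0_ltr_powR ?nnegrE ?mulr_gt0// ?(ltW h0)//.
  have := xh (Ordinal n0); rewrite mxE => /andP[xi _].
  apply: lt_le_trans xi _; apply: le_trans (ler_coord_norm x (Ordinal n0)).
  exact: ler_norm.
have := le_hausdorff_content beta sub.
rewrite (hausdorff_content_cube _ b0 bn h0) => le_lev.
have I0 : 0 < 2%:E * I beta Q W.
  apply: lt_le_trans (choquet_integral_ge_level beta Q W t0).
  rewrite mule_gt0 ?lte_fin//; apply: lt_le_trans le_lev.
  by rewrite lte_fin powR_gt0.
by rewrite lt_neqAle choquet_integral_ge0 andbT; apply: contraTN I0 => /eqP <-;
  rewrite mule0 ltxx.
Qed.

End strictness.

Theorem proposition2p17 (R : realType) (n : nat) (delta beta p : R)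
    (hdelta : 0 < delta) (hdb : delta < beta) (hbeta : beta <= n%:R)
    (hp : 1 <= p) :
  (1 < p ->
     Ap_class n p delta `<` Ap_class n ((p * delta + beta - delta) / beta) beta
     /\ Ap_class n ((p * delta + beta - delta) / beta) beta
        `<` Ap_class n p beta) /\
  (p = 1 -> A1_class n delta `<` A1_class n beta).
Proof.
have b0 := lt_trans hdelta hdb; have dn := le_trans (ltW hdb) hbeta.
have db : 0 < delta <= beta by rewrite hdelta ltW.
have db' : 0 < delta < beta by rewrite hdelta.
split=> [p1|_]; last first.
  split; first exact: A1_class_le.
  move=> /(_ _ (singular_weight_A1_class db' hbeta)) [].
  by move=> /(singular_weight_not_capacitary hdelta dn).
set q := (_ / _).
have p10 : 0 < p - 1 by rewrite subr_gt0.
have qE : q - 1 = (p - 1) * delta / beta by rewrite /q; field; rewrite gt_eqF.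
have q1 : 1 < q by rewrite -subr_gt0 qE divr_gt0// mulr_gt0.
have qp : q < p by rewrite -(ltrD2r (- 1)) qE ltr_pdivrMr// ltr_pM2l.
have q1p : 1 < q <= p by rewrite q1 ltW.
split; split.
- exact: Ap_class_le_dim.
- move=> /(_ _ (singular_weight_Ap_class db' hbeta q1)) [].
  by move=> /(singular_weight_not_capacitary hdelta dn).
- exact: Ap_class_le_exp.
- have ab : 0 < beta * (q - 1) < beta * (p - 1).
    by rewrite mulr_gt0 ?subr_gt0//= ltr_pM2l// ltrD2r.
  move=> /(_ _ (power_weight_Ap_class p1 ab hbeta)).
  exact: power_weight_not_Ap.
Qed.
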